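(* Let $p$ be a prime, $d,s\ge1$, $K$ a number field with ring of integers $\mathcal{O}_K$, and let $f\in M_s(\mathcal{O}_K[t_1^{\pm1},\dots,t_d^{\pm1}])$. Assume that $N_{K/\mathbb{Q}}(\det f)$ does not vanish at any point of $T_p^d=\{(z_1,\dots,z_d)\in\mathbb{C}_p^d:|z_1|_p=\dots=|z_d|_p=1\}$. Let $X_f$ be the Pontryagin dual of $\mathcal{O}_K[t_1^{\pm1},\dots,t_d^{\pm1}]^s/f\,\mathcal{O}_K[t_1^{\pm1},\dots,t_d^{\pm1}]^s$ with the induced $\mathbb{Z}^d$-action described in the context. Then the $p$-adic entropy $h_p(X_f)$ exists and $$h_p(X_f)=m_p(N_{K/\mathbb{Q}}(\det f)).$$
   Context: $\mathbb{C}_p$ is the completion of an algebraic closure of $\mathbb{Q}_p$ with $|p|_p=p^{-1}$, and $\log_p$ is the $p$-adic logarithm with $\log_p p=0$. Write $t^\nu=t_1^{\nu_1}\cdots t_d^{\nu_d}$. The group $\mathbb{Z}^d$ acts on $\mathcal{O}_K[t^{\pm1}]^s$ componentwise by $\delta\cdot(\sum_\nu a^{(1)}_\nu t^\nu,\dots,\sum_\nu a^{(s)}_\nu t^\nu)=(\sum_\nu a^{(1)}_\nu t^{\nu+\delta},\dots,\sum_\nu a^{(s)}_\nu t^{\nu+\delta})$; this induces an action on the quotient by $f\,\mathcal{O}_K[t^{\pm1}]^s$ and, by duality, on $X_f$. $\mathrm{Fix}_{(n\mathbb{Z})^d}(X)$ is the set of points fixed by $(n\mathbb{Z})^d$, and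 $h_p(X)=\lim_{n\to\infty,\,(n,p)=1}\frac1{n^d}\log_p|\mathrm{Fix}_{(n\mathbb{Z})^d}(X)|$ when the limit exists. For $g\in\mathbb{C}_p[t^{\pm1}]$, $m_p(g)=\lim_{N\to\infty,\,(N,p)=1}\frac1{N^d}\sum_{\zeta\in\mu_N^d}\log_p g(\zeta)$ when it exists, where $\mu_N=\{z\in\mathbb{C}_p:z^N=1\}$. For $g=\sum_\nu a_\nu t^\nu\in\mathcal{O}_K[t^{\pm1}]$, $N_{K/\mathbb{Q}}(g)=\prod_{\tau:K\hookrightarrow\mathbb{C}}\sum_\nu\tau(a_\nu)t^\nu\in\mathbb{Z}[t^{\pm1}]$, viewed with coefficients in $\mathbb{Z}\subset\mathbb{C}_p$. *)

(* Defs.v *)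
From HB Require Import structures.
From mathcomp Require Import all_boot all_order all_algebra fieldext.
From mathcomp Require Import finmap.
From mathcomp.multinomials Require Import monalg.
From mathcomp Require Import all_classical all_reals.
From mathcomp.real_closed Require Import complex.

Set Implicit Arguments.
Unset Strict Implicit.
Unset Printing Implicit Defensive.

Import Order.TTheory GRing.Theory Num.Theory.
Local Open Scope classical_set_scope.
Local Open Scope ring_scope.

(* Laurent polynomials in d variables over A: finitely supported functions
   from the exponents 'rV[int]_d to A.  The carrier is the one of [monalg],
   but its ring structure is not available here, because it requires monoids
   of exponents in which only 1 is invertible. *)
Definition laurent (d : nat) (A : nzRingType) : Type := {malg A['rV[int]_d]}.

HB.instance Definition _ d (A : nzRingType) :=
  GRing.Lmodule.copy (laurent d A) {malg A['rV[int]_d]}.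

Section LaurentRing.
Variables (d : nat) (A : nzRingType).
Local Notation Z := 'rV[int]_d.
Implicit Types (g : laurent d A) (k : Z).

Definition lone : laurent d A := << 1 *g (0 : Z) >>.

Definition lmul g1 g2 : laurent d A :=
  \sum_(k1 <- msupp g1) \sum_(k2 <- msupp g2)
    << g1@_k1 * g2@_k2 *g (k1 + k2)%R >>.

Local Open Scope fset_scope.

Lemma lmulw (d1 d2 : {fset Z}) g1 g2 :
  msupp g1 `<=` d1 -> msupp g2 `<=` d2 ->
  lmul g1 g2 = \sum_(k1 <- d1) \sum_(k2 <- d2)
    << g1@_k1 * g2@_k2 *g (k1 + k2)%R >>.
Proof.
move=> le_d1 le_d2; rewrite /lmul (big_fset_incl _ le_d1) /=.
  apply/eq_bigr=> k1 _; apply/big_fset_incl => // k _ /mcoeff_outdom ->.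
  by rewrite mulr0 monalgU0.
move=> k _ /mcoeff_outdom g1k.
by rewrite big1 => // k' _; rewrite g1k mul0r monalgU0.
Qed.

Lemma lmulUU (c1 c2 : A) k1 k2 :
  lmul << c1 *g k1 >> << c2 *g k2 >> = << c1 * c2 *g (k1 + k2)%R >>.
Proof. by rewrite (lmulw msuppU_le msuppU_le) !big_seq_fset1 !mcoeffUU. Qed.

Lemma lmulDl : left_distributive lmul +%R.
Proof.
move=> g1 g2 g.
rewrite (lmulw (msuppD_le g1 g2) (fsubset_refl (msupp g))).
rewrite (lmulw (fsubsetUl (msupp g1) (msupp g2)) (fsubset_refl (msupp g))).
rewrite (lmulw (fsubsetUr (msupp g1) (msupp g2)) (fsubset_refl (msupp g))).
rewrite -big_split /=; apply/eq_bigr=> k1 _.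
rewrite -big_split /=; apply/eq_bigr=> k2 _.
by rewrite mcoeffD mulrDl monalgUD.
Qed.

Lemma lmulDr : right_distributive lmul +%R.
Proof.
move=> g g1 g2.
rewrite (lmulw (fsubset_refl (msupp g)) (msuppD_le g1 g2)).
rewrite (lmulw (fsubset_refl (msupp g)) (fsubsetUl (msupp g1) (msupp g2))).
rewrite (lmulw (fsubset_refl (msupp g)) (fsubsetUr (msupp g1) (msupp g2))).
rewrite -big_split /=; apply/eq_bigr=> k1 _.
rewrite -big_split /=; apply/eq_bigr=> k2 _.
by rewrite mcoeffD mulrDr monalgUD.
Qed.

Lemma lmul0g : left_zero 0 lmul.
Proof. by move=> g; rewrite /lmul msupp0 big_seq_fset0. Qed.

Lemma lmulg0 : right_zero 0 lmul.
Proof.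
by move=> g; rewrite /lmul big1// => k _; rewrite msupp0 big_seq_fset0.
Qed.

Lemma lmul_suml (I : Type) (s : seq I) (F : I -> laurent d A) g :
  lmul (\sum_(i <- s) F i) g = \sum_(i <- s) lmul (F i) g.
Proof.
by apply: (big_morph (lmul^~ g)) => [x y|]; [exact: lmulDl|exact: lmul0g].
Qed.

Lemma lmul_sumr (I : Type) (s : seq I) (F : I -> laurent d A) g :
  lmul g (\sum_(i <- s) F i) = \sum_(i <- s) lmul g (F i).
Proof.
by apply: (big_morph (lmul g)) => [x y|]; [exact: lmulDr|exact: lmulg0].
Qed.

Lemma laurentE g : g = \sum_(k <- msupp g) << g@_k *g k >> :> laurent d A.
Proof. exact: monalgE. Qed.

Lemma lmulA : associative lmul.
Proof.
pose m g k : laurent d A := << g@_k *g k >>.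
move=> g1 g2 g3.
have E1 x : lmul g1 x = \sum_(k <- msupp g1) lmul (m g1 k) x.
  by rewrite {1}(laurentE g1) (lmul_suml _ (m g1)).
have E2 x y : lmul (lmul x g2) y =
    \sum_(k <- msupp g2) lmul (lmul x (m g2 k)) y.
  rewrite {1}(laurentE g2) (lmul_sumr _ (m g2)).
  by rewrite (lmul_suml _ (fun k => lmul x (m g2 k))).
have E3 x : lmul x g3 = \sum_(k <- msupp g3) lmul x (m g3 k).
  by rewrite {1}(laurentE g3) (lmul_sumr _ (m g3)).
rewrite E1 E1 (lmul_suml _ (fun k => lmul (m g1 k) g2)).
apply: eq_bigr => k1 _; rewrite E2 {1}(laurentE g2) (lmul_suml _ (m g2)).
rewrite (lmul_sumr _ (fun k => lmul (m g2 k) g3)).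
apply: eq_bigr => k2 _; rewrite !E3.
rewrite (lmul_sumr _ (fun k => lmul (m g2 k2) (m g3 k))).
by apply: eq_bigr => k3 _; rewrite !lmulUU mulrA addrA.
Qed.

Lemma lmul1g : left_id lone lmul.
Proof.
move=> g; rewrite {1}(laurentE g) lmul_sumr [RHS]laurentE.
by apply/eq_bigr=> k _; rewrite lmulUU mul1r add0r.
Qed.

Lemma lmulg1 : right_id lone lmul.
Proof.
move=> g; rewrite {1}(laurentE g) lmul_suml [RHS]laurentE.
by apply/eq_bigr=> k _; rewrite lmulUU mulr1 addr0.
Qed.

Lemma lone_neq0 : lone != 0.
Proof. by rewrite /lone monalgU_eq0 oner_eq0. Qed.

HB.instance Definition _ := GRing.Zmodule_isNzRing.Build (laurent d A)
  lmulA lmul1g lmulg1 lmulDl lmulDr lone_neq0.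

End LaurentRing.

Section LaurentComRing.
Variables (d : nat) (A : comNzRingType).

Lemma laurent_mulC : @commutative (laurent d A) _ *%R.
Proof.
move=> g1 g2; rewrite /GRing.mul /= /lmul exchange_big /=.
by apply/eq_bigr=> k1 _; apply/eq_bigr=> k2 _; rewrite mulrC addrC.
Qed.

HB.instance Definition _ :=
  GRing.PzRing_hasCommutativeMul.Build (laurent d A) laurent_mulC.

End LaurentComRing.

Definition lmonom (d : nat) (A : nzRingType) (delta : 'rV[int]_d) :
  laurent d A := << 1 *g delta >>.

Lemma lmonomD d (A : nzRingType) (delta eps : 'rV[int]_d) :
  lmonom A (delta + eps) = lmonom A delta * lmonom A eps.
Proof. by rewrite /GRing.mul /= lmulUU mulr1. Qed.

Lemma lmonomM_coeff d (A : nzRingType) (delta nu : 'rV[int]_d)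
    (g : laurent d A) : (lmonom A delta * g)@_(nu + delta) = g@_nu.
Proof.
rewrite {1}(laurentE g) mulr_sumr [in RHS](laurentE g) !raddf_sum /=.
apply/eq_bigr=> k _; rewrite /GRing.mul /= lmulUU mul1r !mcoeffU.
by rewrite addrC (inj_eq (addIr delta)).
Qed.

Definition laurent_map (d : nat) (A B : nzRingType) (h : A -> B)
    (g : laurent d A) : laurent d B :=
  \sum_(nu <- msupp g) << h g@_nu *g nu >>.

Definition laurent_eval (d : nat) (F : fieldType) (g : laurent d F)
    (z : 'rV[F]_d) : F :=
  \sum_(nu <- msupp g) g@_nu * \prod_i z 0 i ^ nu 0 i.

Section RingOfIntegers.
Variable K : fieldExtType rat.

Definition alg_int : pred K :=
  fun x => `[< integralOver (intr : int -> K) x >].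

Lemma alg_int_subring : subring_closed alg_int.
Proof.
split=> [|x y /asboolP xi /asboolP yi|x y /asboolP xi /asboolP yi];
  apply/asboolP; [exact: integral1|exact: integral_sub|exact: integral_mul].
Qed.

HB.instance Definition _ := GRing.isSubringClosed.Build K alg_int
  alg_int_subring.

Record ring_of_integers := RingOfIntegers {
  roi_val :> K;
  roi_valP : roi_val \in alg_int }.

HB.instance Definition _ := [isSub for roi_val].
HB.instance Definition _ := [Choice of ring_of_integers by <:].
HB.instance Definition _ :=
  [SubChoice_isSubComNzRing of ring_of_integers by <:].

End RingOfIntegers.

Section FieldNorm.
Variables (R : realType) (K : fieldExtType rat) (d : nat).
Implicit Types g : laurent d (ring_of_integers K).

(* The finite set of embeddings of K has no canonical enumeration:
   {classic _} only makes it possible to use it as a set of indices. *)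
Definition complex_norm g : laurent d R[i] :=
  \big[*%R/1]_(tau \in [set: {classic {rmorphism K -> R[i]}}])
    laurent_map
      (fun a : ring_of_integers K => (tau : {rmorphism K -> R[i]}) (\val a)) g.

(* The product above has coefficients in Z; field_norm is the unique Laurent
   polynomial over int with this image over R[i]. *)
Definition field_norm g : laurent d int :=
  xget 0 [set G | laurent_map (intr : int -> R[i]) G = complex_norm g].

End FieldNorm.

Section DualModule.
Variables (A : comNzRingType) (d s : nat) (f : 'M[laurent d A]_s).

Definition image_mx (v : 'cV[laurent d A]_s) : bool :=
  `[< exists w : 'cV[laurent d A]_s, v = f *m w >].

Lemma image_mx_zmod : zmod_closed image_mx.
Proof.
split=> [|v w /asboolP[v' ->] /asboolP[w' ->]]; apply/asboolP.
  by exists 0; rewrite mulmx0.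
by exists (v' - w'); rewrite mulmxBr.
Qed.

HB.instance Definition _ := GRing.isZmodClosed.Build _ image_mx image_mx_zmod.

Definition image_submod : zmodClosed 'cV[laurent d A]_s :=
  GRing.ZmodClosed.clone _ image_mx _.

Definition coker_mx : zmodType := {ideal_quot image_submod}.

Definition coker_act (delta : 'rV[int]_d) (x : coker_mx) : coker_mx :=
  \pi_({ideal_quot image_submod})%qT
    (lmonom A delta *: repr (x : {ideal_quot image_submod})).

Lemma coker_act_pi delta (v : 'cV[laurent d A]_s) :
  coker_act delta (\pi_({ideal_quot image_submod})%qT v) =
  \pi_({ideal_quot image_submod})%qT (lmonom A delta *: v).
Proof.
apply/eqP; rewrite -Quotient.idealrBE -scalerBr.
have /asboolP[w Ew] : repr (\pi_({ideal_quot image_submod})%qT v) - v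
    \in image_submod by rewrite Quotient.idealrBE reprK.
by apply/asboolP; exists (lmonom A delta *: w); rewrite Ew -scalemxAr.
Qed.

Lemma coker_actD delta : {morph coker_act delta : x y / x + y}.
Proof.
move=> x y; rewrite -[x]reprK -[y]reprK.
rewrite -(raddfD (\pi_({ideal_quot image_submod})%qT)) !coker_act_pi.
by rewrite scalerDr raddfD.
Qed.

Lemma coker_act0 x : coker_act 0 x = x.
Proof.
rewrite -[x]reprK coker_act_pi.
by congr (\pi_({ideal_quot image_submod})%qT _); apply: scale1r.
Qed.

Lemma coker_actA delta eps x :
  coker_act (delta + eps) x = coker_act delta (coker_act eps x).
Proof.
rewrite -[x]reprK (coker_act_pi eps) (coker_act_pi delta).
by rewrite (coker_act_pi (delta + eps)) lmonomD -scalerA.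
Qed.

End DualModule.

(* The Pontryagin dual of a discrete abelian group M: every homomorphism from M
   to the unit circle of the complex numbers R[i] is continuous.  The compact
   topology of the dual is omitted: fixed points do not depend on it. *)
Section PontryaginDual.
Variables (R : realType) (M : zmodType).

Record pontryagin_dual := PontryaginDual {
  char_val :> M -> R[i];
  char_valD : forall x y, char_val (x + y) = char_val x * char_val y;
  char_norm : forall x, `|char_val x| = 1 }.

Variables (a : M -> M) (aD : {morph a : x y / x + y}).

Lemma dual_map_valD (chi : pontryagin_dual) x y :
  chi (a (x + y)) = chi (a x) * chi (a y).
Proof. by rewrite aD char_valD. Qed.

Definition dual_map (chi : pontryagin_dual) : pontryagin_dual :=
  PontryaginDual (dual_map_valD chi) (fun x => char_norm chi (a x)).

End PontryaginDual.

Section DualSystem.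
Variables (R : realType) (A : comNzRingType) (d s : nat).
Variable f : 'M[laurent d A]_s.

Definition Xdual : Type := pontryagin_dual R (coker_mx f).

Definition Xdual_act (delta : 'rV[int]_d) : Xdual -> Xdual :=
  dual_map (@coker_actD A d s f delta).

End DualSystem.

Section Completion.
Variable R : realType.

Definition is_abs_value (F : fieldType) (v : F -> R) : Prop :=
  [/\ forall x, 0 <= v x,
      forall x, v x = 0 <-> x = 0,
      forall x y, v (x * y) = v x * v y &
      forall x y, v (x + y) <= Num.max (v x) (v y)].

Definition abs_cvg (F : fieldType) (v : F -> R) (u : nat -> F) (l : F) : Prop :=
  forall e : R, 0 < e -> exists N, forall n, (N <= n)%N -> v (u n - l) < e.

Definition abs_cauchy (F : fieldType) (v : F -> R) (u : nat -> F) : Prop :=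
  forall e : R, 0 < e -> exists N, forall m n,
    (N <= m)%N -> (N <= n)%N -> v (u m - u n) < e.

Definition is_completion (F E : fieldType) (vF : F -> R) (vE : E -> R)
    (h : F -> E) : Prop :=
  [/\ is_abs_value vE,
      forall x, vE (h x) = vF x,
      forall (y : E) (e : R), 0 < e -> exists x, vE (y - h x) < e &
      forall u, abs_cauchy vE u -> exists l, abs_cvg vE u l].

Definition rat_abs (p : nat) (x : rat) : R :=
  if x == 0 then 0
  else p%:R ^+ logn p `|denq x|%N / p%:R ^+ logn p `|numq x|%N.

(* A model of C_p: a completion of an algebraic closure of a completion of
   the rationals for the p-adic absolute value, together with the (unique)
   extensions of that absolute value. *)
Record padic_complex (p : nat) := PadicComplex {
  Qp : fieldType;
  Qp_abs : Qp -> R;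
  Qp_of_rat : {rmorphism rat -> Qp};
  QpP : is_completion (rat_abs p) Qp_abs Qp_of_rat;
  Qpbar : fieldType;
  Qpbar_abs : Qpbar -> R;
  Qpbar_of_Qp : {rmorphism Qp -> Qpbar};
  Qpbar_algebraic : forall x, algebraicOver Qpbar_of_Qp x;
  Qpbar_closed : GRing.closed_field_axiom Qpbar;
  Qpbar_absP : is_abs_value Qpbar_abs;
  Qpbar_absE : forall x, Qpbar_abs (Qpbar_of_Qp x) = Qp_abs x;
  Cp :> fieldType;
  Cp_abs : Cp -> R;
  Cp_of_Qpbar : {rmorphism Qpbar -> Cp};
  CpP : is_completion Qpbar_abs Cp_abs Cp_of_Qpbar }.

End Completion.

Section Padic.
Variables (R : realType) (p : nat) (C : padic_complex R p).
Local Notation abs := (@Cp_abs R p C).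

(* The conditions determine L; the value at 0 is a convention. *)
Definition is_padic_log (L : C -> C) : Prop :=
  [/\ L 0 = 0,
      forall x y, x != 0 -> y != 0 -> L (x * y) = L x + L y,
      L p%:R = 0 &
      forall x, abs x < 1 ->
        abs_cvg abs (fun n => \sum_(k < n) (-1) ^+ k * x ^+ k.+1 / k.+1%:R)
          (L (1 + x))].

Definition padic_log : C -> C := xget (fun=> 0) is_padic_log.

Definition coprime_cvg (u : nat -> C) (l : C) : Prop :=
  forall e : R, 0 < e -> exists N, forall n,
    (N <= n)%N -> coprime n p -> abs (u n - l) < e.

Section Entropy.
Variables (d : nat) (X : Type) (act : 'rV[int]_d -> X -> X).

Definition Fix (n : nat) : set X :=
  [set x | forall delta : 'rV[int]_d,
    (forall i, (n %| delta ord0 i)%Z) -> act delta x = x].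

(* Every term of the sequence has to be defined: the sets of fixed points are
   finite, and c n is the cardinal of Fix n. *)
Definition has_padic_entropy (h : C) : Prop :=
  exists c : nat -> nat,
    (forall n, coprime n p -> (Fix n #= `I_(c n))%card) /\
    coprime_cvg (fun n => (n%:R ^+ d)^-1 * padic_log (c n)%:R) h.

End Entropy.

Section Mahler.
Variables (d : nat) (g : laurent d C).

Definition unit_torus : set 'rV[C]_d :=
  [set z | forall i, abs (z 0 i) = 1].

Definition mu_torus (N : nat) : set 'rV[C]_d :=
  [set z | forall i, z 0 i ^+ N = 1].

Definition has_padic_mahler (m : C) : Prop :=
  (forall N, coprime N p ->
     forall z, mu_torus N z -> laurent_eval g z != 0) /\
  coprime_cvg (fun N => (N%:R ^+ d)^-1 *
    \sum_(z \in mu_torus N) padic_log (laurent_eval g z)) m.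

End Mahler.
End Padic.

(* Main.v *)
(** Modulo (nZ)^d the module attached to [f] becomes the cokernel of an integer
    matrix Phi_n, so the fixed points are the characters of a free abelian group
    that kill the image of Phi_n; by the Smith normal form there are |det Phi_n|
    of them.  The embeddings of K together with the evaluations at the points of
    mu_n^d put Phi_n in block diagonal form, whence det Phi_n is the product of
    the values F(zeta), zeta in mu_n^d, where F = N(det f).  This is an identity
    between integers, so it also holds for the roots of unity of C_p: the n-th
    terms of the two sequences agree, and only their convergence is at stake.

    As F has no zero on T_p^d, a Newton polygon argument provides a strictly
    dominant coefficient: F = c t^nu (1 + h), where |h| <= rho < 1 on T_p^d.
    Roots of unity have logarithm 0, so log F(zeta) = log c + log (1 + h(zeta)).
    The logarithmic series can be truncated uniformly on |x| <= rho, and the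
    mean over mu_n^d of a Laurent polynomial is its constant coefficient for
    large n; hence the means form a Cauchy sequence. *)

Require Import Defs.
From HB Require Import structures.
From mathcomp Require Import all_boot all_order all_algebra fieldext.
From mathcomp Require Import perm cyclic falgebra separable closed_field.
From mathcomp Require Import cyclotomic algC algnum finmap ring.
From mathcomp.multinomials Require Import monalg.
From mathcomp Require Import all_classical all_reals.
From mathcomp.real_closed Require Import complex.

Set Implicit Arguments.
Unset Strict Implicit.
Unset Printing Implicit Defensive.

Import Order.TTheory GRing.Theory Num.Theory.
Local Open Scope classical_set_scope.
Local Open Scope ring_scope.

(** * Block diagonal determinants *)

Lemma det_mxdiag (R : comNzRingType) n (p_ : 'I_n -> nat)
    (B_ : forall i, 'M[R]_(p_ i)) :
  \det (\mxdiag_i B_ i) = \prod_i \det (B_ i).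
Proof.
elim: n p_ B_ => [|m IHm] q_ B_.
  by move: (\mxdiag__ _); rewrite !big_ord0 => M; rewrite det_mx00.
rewrite mxdiag_recl [RHS]big_ord_recl/= -IHm.
by case: _ / mxsize_recl; rewrite ?castmx_id det_ublock.
Qed.

Lemma det_reindex (R : comNzRingType) m n (g : 'I_m -> 'I_n) (A : 'M[R]_n)
    (B : 'M[R]_m) :
  bijective g -> (forall i j, B i j = A (g i) (g j)) -> \det B = \det A.
Proof.
move=> gbij BE; have mn : m = n by have := bij_eq_card gbij; rewrite !card_ord.
case: n / mn in g A gbij BE *.
pose s := perm (bij_inj gbij).
have -> : B = row_perm s (col_perm s A).
  by apply/matrixP => i j; rewrite !mxE BE !permE.
rewrite row_permE col_permE !det_mulmx !det_perm mulrC -mulrA -signr_addb.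
by rewrite odd_permV addbb mulr1.
Qed.

Lemma det_block (R : comNzRingType) (I T : finType) s (h : I -> T * 'I_s)
    (B : T -> 'M[R]_s) (M : 'M[R]_#|I|) : bijective h ->
  (forall i j, M (enum_rank i) (enum_rank j) =
     (B (h i).1 (h i).2 (h j).2) *+ ((h i).1 == (h j).1)) ->
  \det M = \prod_t \det (B t).
Proof.
move=> hbij ME; case: (hbij) => h' hK h'K.
rewrite (reindex (enum_val : 'I_#|T| -> T)); last first.
  by exists enum_rank => x _; rewrite ?enum_valK ?enum_rankK.
rewrite -det_mxdiag /=; apply/esym.
pose g (k : 'I_(\sum_(i < #|T|) s)) : 'I_#|I| :=
  enum_rank (h' (enum_val (tagnat.sig1 k), tagnat.sig2 k)).
apply: (@det_reindex _ _ _ g).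
  pose g' (x : 'I_#|I|) : 'I_(\sum_(i < #|T|) s) :=
    let y := h (enum_val x) in tagnat.Rank (enum_rank y.1) y.2.
  exists g' => x; rewrite /g /g'.
    rewrite enum_rankK h'K /= enum_valK -[RHS]tagnat.sigK.
    by rewrite /tagnat.Rank /tagnat.sig1 /tagnat.sig2; case: (tagnat.sig x).
  rewrite tagnat.Rank1K tagnat.Rank2K /= enum_rankK cast_ord_id.
  by rewrite -surjective_pairing hK enum_valK.
move=> i j; rewrite /g ME !h'K /= !mxE.
rewrite (inj_eq enum_val_inj).
by case: eqVneq => [->|ne]; rewrite ?conform_mx_id// mxE.
Qed.

(** * Laurent polynomials and their values on the torus *)

Definition mono d (A : nzRingType) (nu : 'rV[int]_d) (a : A) : laurent d A :=
  << a *g nu >>.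

Lemma monoM d (A : nzRingType) (a b : A) (k l : 'rV[int]_d) :
  mono k a * mono l b = mono (k + l) (a * b).
Proof. exact: lmulUU. Qed.

Lemma lmonomE d (A : nzRingType) (nu : 'rV[int]_d) : lmonom A nu = mono nu 1.
Proof. by []. Qed.

Lemma mono_is_zmod_morphism d (A : nzRingType) (nu : 'rV[int]_d) :
  zmod_morphism (mono nu : A -> _).
Proof. exact: monalgUB. Qed.

HB.instance Definition _ d (A : nzRingType) (nu : 'rV[int]_d) :=
  GRing.isZmodMorphism.Build A (laurent d A) (mono nu)
    (@mono_is_zmod_morphism d A nu).

Lemma laurent_mono d (A : nzRingType) (g : laurent d A) :
  g = \sum_(nu <- msupp g) mono nu g@_nu.
Proof. exact: laurentE. Qed.

Section Evaluation.
Variables (d : nat) (F : fieldType).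
Implicit Types (z : 'rV[F]_d) (nu : 'rV[int]_d).

Definition monom_val z nu : F := \prod_i z 0 i ^ nu 0 i.

Lemma monom_val0 z : monom_val z 0 = 1.
Proof. by rewrite /monom_val big1// => i _; rewrite mxE expr0z. Qed.

Lemma monom_valD z nu mu : (forall i, z 0 i != 0) ->
  monom_val z (nu + mu) = monom_val z nu * monom_val z mu.
Proof.
move=> z0; rewrite -big_split; apply: eq_bigr => i _.
by rewrite mxE expfzDr.
Qed.

Variables (A : comNzRingType) (tau : {rmorphism A -> F}).

Definition leval z (g : laurent d A) : F := mmap tau (monom_val z) g.

Lemma levalU z a nu : leval z (mono nu a) = tau a * monom_val z nu.
Proof. exact: mmapU. Qed.

Lemma levalB z : {morph leval z : g1 g2 / g1 - g2}.
Proof. exact: mmapB. Qed.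

HB.instance Definition _ z :=
  GRing.isZmodMorphism.Build (laurent d A) F (leval z) (levalB z).

Lemma leval1 z : leval z 1 = 1.
Proof. by rewrite levalU rmorph1 monom_val0 mulr1. Qed.

Lemma levalM z g1 g2 : (forall i, z 0 i != 0) ->
  leval z (g1 * g2) = leval z g1 * leval z g2.
Proof.
move=> z0; rewrite [g1]laurent_mono [g2]laurent_mono.
rewrite mulr_suml !raddf_sum mulr_suml; apply: eq_bigr => k1 _.
rewrite mulr_sumr raddf_sum mulr_sumr; apply: eq_bigr => k2 _.
by rewrite monoM /= !levalU rmorphM monom_valD// mulrACA.
Qed.

Lemma leval_rmorphism z : (forall i, z 0 i != 0) ->
  {phi : {rmorphism laurent d A -> F} | phi =1 leval z}.
Proof.
move=> z0.
have hM : GRing.monoid_morphism (leval z).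
  by split; [exact: leval1 | move=> g1 g2; exact: levalM].
pose phiM := GRing.isMonoidMorphism.Build (laurent d A) F (leval z) hM.
pose phi : {rmorphism laurent d A -> F} := HB.pack (leval z) phiM.
by exists phi.
Qed.

Lemma leval_det s z (f : 'M[laurent d A]_s) : (forall i, z 0 i != 0) ->
  leval z (\det f) = \det (map_mx (leval z) f).
Proof.
move=> /leval_rmorphism[phi phiE]; rewrite -phiE -det_map_mx.
by congr (\det _); apply/matrixP => i j; rewrite !mxE phiE.
Qed.

End Evaluation.

Lemma laurent_eval_map d (F : fieldType) (A : comNzRingType)
    (tau : {rmorphism A -> F}) (g : laurent d A) z :
  laurent_eval (laurent_map tau g) z = leval tau z g.
Proof.
have E h : laurent_eval h z = leval idfun z h by [].
rewrite E /laurent_map raddf_sum; apply: eq_bigr => k _.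
by rewrite /= levalU.
Qed.

Section Torus.
Variables (d n' : nat).
Local Notation n := n'.+1.
Local Notation G := {ffun 'I_d -> 'I_n}.

Definition res (nu : 'rV[int]_d) : G :=
  [ffun i => inord `|(nu 0%R i %% n)%Z|%N].

Definition lft (a : G) : 'rV[int]_d := \row_i (a i : nat)%:Z.

Lemma resE nu i : (res nu i : nat) = (nu 0%R i %% n)%Z :> int.
Proof.
have n0 : (n : int) != 0 by [].
rewrite ffunE inordK; first by rewrite gez0_abs ?modz_ge0.
by rewrite -ltz_nat gez0_abs ?modz_ge0// ltz_pmod.
Qed.

Lemma res_eq nu mu : (res nu == res mu) =
  [forall i, (n %| (nu - mu) 0%R i)%Z].
Proof.
apply/eqP/forallP => [E i|E].
  by rewrite !mxE -eqz_mod_dvd -!resE E.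
apply/ffunP => i; apply/val_inj/eqP; rewrite -eqz_nat !resE.
by have := E i; rewrite !mxE -eqz_mod_dvd.
Qed.

Lemma lftK : cancel lft res.
Proof.
move=> a; apply/ffunP => i; apply/val_inj/eqP.
by rewrite -eqz_nat resE mxE modz_nat modn_small.
Qed.

Lemma resK nu : res (lft (res nu)) = res nu.
Proof. exact: lftK. Qed.

Variables (F : fieldType) (w : F).
Hypothesis w_prim : n.-primitive_root w.

Definition tpt (b : G) : 'rV[F]_d := \row_i w ^+ b i.

Lemma w_neq0 : w != 0.
Proof.
apply: contra_eq_neq (prim_expr_order w_prim) => ->.
by rewrite expr0n eq_sym oner_neq0.
Qed.

Lemma tpt_neq0 b i : tpt b 0 i != 0.
Proof. by rewrite mxE expf_neq0// w_neq0. Qed.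

Lemma prim_exprz_eq1 (k : int) : (w ^ k == 1) = (n %| k)%Z.
Proof.
case: k => k.
  by rewrite dvdzE/= -(prim_order_dvd w_prim).
by rewrite NegzE -exprnN invr_eq1 dvdzE abszN/= (prim_order_dvd w_prim).
Qed.

Lemma tpt_expz b i (k : int) : tpt b 0 i ^ k = (w ^ k) ^+ b i.
Proof.
by rewrite mxE !exprnP exprzAC.
Qed.

Lemma monom_val_res b nu mu : res nu = res mu ->
  monom_val (tpt b) nu = monom_val (tpt b) mu.
Proof.
move/eqP; rewrite res_eq => /forallP h; apply: eq_bigr => i _.
have E : w ^ (nu 0 i - mu 0 i) = 1.
  by apply/eqP; rewrite prim_exprz_eq1; have := h i; rewrite !mxE.
rewrite !tpt_expz; congr (_ ^+ _).
by rewrite -(subrK (mu 0 i) (nu 0 i)) expfzDr ?w_neq0// E mul1r.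
Qed.

Lemma sum_exprz (k : int) :
  \sum_(j < n) (w ^ k) ^+ j = n%:R *+ (n %| k)%Z.
Proof.
have [|ndvd] := boolP (n %| k)%Z.
  rewrite -prim_exprz_eq1 => /eqP ->.
  under eq_bigr do rewrite expr1n.
  by rewrite sumr_const card_ord.
have : (w ^ k) ^+ n - 1 = 0.
  by rewrite exprnP exprzAC -exprnP (prim_expr_order w_prim) exp1rz subrr.
rewrite subrX1 => /eqP; rewrite mulf_eq0 subr_eq0 prim_exprz_eq1.
by rewrite (negPf ndvd) => /eqP.
Qed.

Lemma sum_tpt nu : \sum_b monom_val (tpt b) nu =
  n%:R ^+ d *+ (res nu == res 0).
Proof.
transitivity (\prod_(i < d) \sum_(j < n) (w ^ nu 0 i) ^+ j).
  rewrite bigA_distr_bigA; apply: eq_bigr => b _.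
  by apply: eq_bigr => i _; rewrite tpt_expz.
rewrite res_eq subr0; have [/forallP h|] := boolP [forall i, (n %| nu 0%R i)%Z].
  under eq_bigr => i _ do rewrite sum_exprz h.
  by rewrite prodr_const card_ord.
rewrite negb_forall => /existsP[i ni].
by rewrite (bigD1 i)//= sum_exprz (negPf ni) mul0r.
Qed.

End Torus.

(** * The module modulo (nZ)^d as a free abelian group *)

Lemma mulrz_mxE (V : zmodType) m n (M : 'M[V]_(m, n)) (k : int) i j :
  (M *~ k) i j = M i j *~ k.
Proof. by case: k => k; rewrite ?NegzE ?mulrNz ?mxE -pmulrn mulmxnE. Qed.

(* The definitions below are locked because a failing conversion between vectors
   of Laurent polynomials is extremely slow. *)
HB.lock Definition gen (A : comNzRingType) d s (a : A) (i : 'I_s)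
    (nu : 'rV[int]_d) : 'cV[laurent d A]_s :=
  \col_l (if l == i then mono nu a else 0).

HB.lock Definition shift (A : comNzRingType) d s (mu : 'rV[int]_d)
  (v : 'cV[laurent d A]_s) : 'cV[laurent d A]_s := scalemx (lmonom A mu) v.

(* Coordinates of [v] modulo the action of (nZ)^d, in the lattice basis of the
   classes of e_k t^a eps_i; here and below n = n'.+1. *)
HB.lock Definition coords (A : comNzRingType) (r d s n' : nat)
    (co : 'I_r -> {additive A -> int}) (v : 'cV[laurent d A]_s) :
    'rV[int]_#|{: 'I_r * 'I_s * {ffun 'I_d -> 'I_n'.+1}}| :=
  \row_j mmap (co (enum_val j).1.1)
    (fun nu => (res n' nu == (enum_val j).2)%:R) (v (enum_val j).1.2 0).

Section Shift.
Variables (A : comNzRingType) (d s : nat).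
Local Notation V := 'cV[laurent d A]_s.
Implicit Types (mu nu : 'rV[int]_d).

Lemma shiftE mu (v : V) : lmonom A mu *: v = shift mu v.
Proof. by rewrite unlock. Qed.

Lemma shift_coef mu (v : V) i : shift mu v i 0 = lmonom A mu * v i 0.
Proof. by rewrite unlock; exact: mxE. Qed.

Lemma shiftB mu : {morph (shift mu : V -> V) : v w / v - w}.
Proof. by move=> v w; apply/colP => i; rewrite !(shift_coef, mxE) mulrBr. Qed.

Lemma shift0 mu : shift mu (0 : V) = 0 :> V.
Proof. by apply/colP => i; rewrite shift_coef !mxE mulr0. Qed.

Lemma shift_mul mu (f : 'M[laurent d A]_s) (v : V) :
  f *m shift mu v = shift mu (f *m v).
Proof.
apply/colP => i; rewrite shift_coef [LHS]mxE [in RHS]mxE mulr_sumr.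
by apply: eq_bigr => j _; rewrite shift_coef mulrCA.
Qed.

(* The instance paths produced by [mulmxBr] make later matching very slow. *)
Lemma mul_laurentB (f : 'M[laurent d A]_s) :
  {morph (mulmx f : V -> V) : v w / v - w}.
Proof. by move=> v w; apply: mulmxBr. Qed.

Lemma gen_coef (a : A) i nu (l : 'I_s) (j : 'I_1) :
  gen a i nu l j = if l == i then mono nu a else 0.
Proof. by rewrite unlock mxE. Qed.

Lemma shift_gen (a : A) (i : 'I_s) nu mu :
  shift mu (gen a i nu) = gen a i (mu + nu).
Proof.
apply/colP => l; rewrite shift_coef !gen_coef.
case: eqP => _; last by rewrite mulr0.
by rewrite lmonomE monoM mul1r.
Qed.

End Shift.

Section PeriodicModule.
Variables (A : comNzRingType) (r d s n' : nat).
Variables (e : 'I_r -> A) (co : 'I_r -> {additive A -> int}).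
Hypothesis coE : forall a, a = \sum_k e k *~ co k a.
Hypothesis co_e : forall k l, co k (e l) = (k == l)%:R.

Local Notation n := n'.+1.
Local Notation G := {ffun 'I_d -> 'I_n}.
Local Notation J := ('I_r * 'I_s * G)%type.
Local Notation res := (res n').
Local Notation V := 'cV[laurent d A]_s.
Local Notation coords := (@coords A r d s n' co).

Definition jgen (j : J) : V := gen (e j.1.1) j.1.2 (lft j.2).

Lemma coordsB : {morph coords : v w / v - w}.
Proof. by move=> v w; apply/rowP => j; rewrite coords.unlock !mxE mmapB. Qed.

HB.instance Definition _ :=
  GRing.isZmodMorphism.Build V 'rV[int]_#|{: J}| coords coordsB.

Lemma gen_ind (P : V -> Prop) :
  P 0 -> (forall v w, P v -> P w -> P (v - w)) ->
  (forall k i nu, P (gen (e k) i nu)) -> forall v, P v.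
Proof.
move=> P0 PB Pg.
have PN v : P v -> P (- v) by move=> Pv; rewrite -sub0r; apply: PB.
have PD v w : P v -> P w -> P (v + w).
  by move=> Pv Pw; rewrite -[w]opprK; apply: PB => //; apply: PN.
have Pz v (m : int) : P v -> P (v *~ m).
  move=> Pv; have Pn (l : nat) : P (v *+ l).
    by elim: l => [|l IH]; rewrite ?mulr0n// mulrS; apply: PD.
  by case: m => m; [apply: Pn | apply/PN/Pn].
move=> v.
have -> : v = \sum_i \sum_(nu <- msupp (v i 0)) \sum_k
    gen (e k) i nu *~ co k (v i 0)@_nu.
  apply/matrixP => l j.
  rewrite ord1 summxE (bigD1 l)//= [X in _ + X]big1 ?addr0.
    rewrite [LHS]laurent_mono summxE; apply: eq_bigr => nu _.
    rewrite summxE [in LHS](coE (v l 0)@_nu).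
    rewrite (raddf_sum (mono nu)).
    apply: eq_bigr => k _.
    by rewrite (raddfMz (mono nu)) mulrz_mxE gen_coef eqxx.
  move=> i il; rewrite summxE big1// => nu _; rewrite summxE big1// => k _.
  by rewrite mulrz_mxE gen_coef eq_sym (negPf il) mul0rz.
by elim/big_ind: _ => // i _; elim/big_ind: _ => // nu _; elim/big_ind: _;
  rewrite // => k _; apply: Pz.
Qed.

Lemma coords_gen k i nu :
  coords (gen (e k) i nu) = delta_mx 0 (enum_rank (k, i, res nu)).
Proof.
apply/rowP => j; rewrite coords.unlock !mxE eqxx gen_coef /=.
rewrite -(inj_eq enum_val_inj) enum_rankK.
case: (enum_val j) => [[k' i'] a] /=; rewrite !xpair_eqE.
case: eqP => _; last by rewrite mmap0 andbF.
by rewrite mmapU co_e andbT -natrM mulnb [res nu == _]eq_sym.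
Qed.

Definition combi (x : 'rV[int]_#|{: J}|) : V :=
  \sum_j jgen (enum_val j) *~ x 0 j.

Lemma combiB : {morph combi : x y / x - y}.
Proof.
move=> x y; rewrite /combi -sumrB; apply: eq_bigr => j _.
by rewrite !mxE mulrzBr.
Qed.

HB.instance Definition _ :=
  GRing.isZmodMorphism.Build 'rV[int]_#|{: J}| V combi combiB.

Lemma combi_delta j : combi (delta_mx 0 (enum_rank j)) = jgen j.
Proof.
rewrite /combi (bigD1 (enum_rank j)) //= big1 ?addr0 => [|i ij].
  have -> : (delta_mx ord0 (enum_rank j) : 'rV[int]_#|{: J}|)
      ord0 (enum_rank j) = 1.
    by rewrite mxE !eqxx.
  by rewrite enum_rankK mulr1z.
by rewrite mxE eqxx (negPf ij) mulr0z.
Qed.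

Lemma coords_jgen j : coords (jgen j) = delta_mx 0 (enum_rank j).
Proof. by rewrite coords_gen lftK -!surjective_pairing. Qed.

Lemma combiK : cancel combi coords.
Proof.
move=> x; rewrite /combi raddf_sum [RHS]row_sum_delta.
apply: eq_bigr => j _.
by rewrite raddfMz /= coords_jgen enum_valK -scaler_int intz.
Qed.

Lemma res_addl (nu mu : 'rV[int]_d) : res mu = res 0 -> res (mu + nu) = res nu.
Proof.
by move=> /eqP; rewrite res_eq subr0 => h; apply/eqP; rewrite res_eq addrK.
Qed.

Lemma coords_shift mu v : res mu = res 0 -> coords (shift mu v) = coords v.
Proof.
move=> mu0; elim/gen_ind: v => [|v w IHv IHw|k i nu]; first by rewrite shift0.
  by rewrite shiftB !coordsB IHv IHw.
by rewrite shift_gen !coords_gen res_addl.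
Qed.

Variable f : 'M[laurent d A]_s.

Definition mul_coords : 'M[int]_#|{: J}| :=
  \matrix_(i, j) coords (f *m jgen (enum_val i)) 0 j.

Lemma coords_mul (v : V) : coords (f *m v) = coords v *m mul_coords.
Proof.
elim/gen_ind: v => [|v w IHv IHw|k i nu].
- by rewrite mulmx0 raddf0 mul0mx.
- rewrite mul_laurentB [LHS]coordsB [X in _ = X *m _]coordsB.
  by rewrite mulmxBl -IHv -IHw.
rewrite coords_gen -rowE -[X in f *m gen _ i X](subrK (lft (res nu))).
rewrite -shift_gen shift_mul [LHS]coords_shift.
  by apply/rowP => j; rewrite !mxE enum_rankK.
by apply/eqP; rewrite res_eq subr0 -res_eq resK.
Qed.

End PeriodicModule.

HB.lock Definition evals (A : comNzRingType) (r d s n' : nat) (F : fieldType)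
    (w : F) (tau : 'I_r -> {rmorphism A -> F}) (v : 'cV[laurent d A]_s) :
    'rV[F]_#|{: 'I_r * 'I_s * {ffun 'I_d -> 'I_n'.+1}}| :=
  \row_j leval (tau (enum_val j).1.1) (tpt w (enum_val j).2)
    (v (enum_val j).1.2 0).

Section Diagonalization.
Variables (A : comNzRingType) (r d s n' : nat).
Variables (e : 'I_r -> A) (co : 'I_r -> {additive A -> int}).
Hypothesis coE : forall a, a = \sum_k e k *~ co k a.
Hypothesis co_e : forall k l, co k (e l) = (k == l)%:R.
Variables (F : fieldType) (w : F) (tau : 'I_r -> {rmorphism A -> F}).

Local Notation n := n'.+1.
Local Notation G := {ffun 'I_d -> 'I_n}.
Local Notation J := ('I_r * 'I_s * G)%type.
Local Notation res := (res n').
Local Notation V := 'cV[laurent d A]_s.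
Local Notation coords := (@coords A r d s n' co).
Local Notation jgen := (@jgen A r d s n' e).
Local Notation evals := (@evals A r d s n' F w tau).

Hypothesis w_prim : n.-primitive_root w.
Hypothesis n_neq0 : n%:R != 0 :> F.
Hypothesis tau_unit : (\matrix_(k, u) tau u (e k)) \in unitmx.

Lemma evals_coef v j : evals v 0 j =
  leval (tau (enum_val j).1.1) (tpt w (enum_val j).2) (v (enum_val j).1.2 0).
Proof. by rewrite evals.unlock mxE. Qed.

Lemma evalsB : {morph evals : v x / v - x}.
Proof.
move=> v x; apply/rowP => j; rewrite [RHS]mxE [X in _ = _ + X]mxE !evals_coef.
rewrite -levalB; congr leval; rewrite mxE; congr (_ + _); exact: mxE.
Qed.

Lemma evals0 : evals 0 = 0.
Proof. by rewrite -(subrr 0) evalsB subrr. Qed.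

Definition eval_mx : 'M[F]_#|{: J}| :=
  \matrix_(i, j) evals (jgen (enum_val i)) 0 j.

Lemma evalsE v : map_mx intr (coords v) *m eval_mx = evals v.
Proof.
elim/(@gen_ind A r d s e co coE): v => [|v x IHv IHx|k i nu].
- by rewrite raddf0 map_mx0 mul0mx evals0.
- by rewrite [coords _]coordsB map_mxB mulmxBl [RHS]evalsB -IHv -IHx.
rewrite (coords_gen _ co_e) map_delta_mx -rowE; apply/rowP => j.
rewrite mxE mxE !evals_coef enum_rankK !gen_coef /=.
case: eqP => _; last by rewrite !raddf0.
by rewrite !levalU; congr (_ * _); apply: monom_val_res => //; exact: resK.
Qed.

Variable f : 'M[laurent d A]_s.

Definition mul_evals : 'M[F]_#|{: J}| :=
  \matrix_(i, j) (leval (tau (enum_val j).1.1) (tpt w (enum_val j).2)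
       (f (enum_val j).1.2 (enum_val i).1.2) *+
     (((enum_val i).1.1, (enum_val i).2) ==
      ((enum_val j).1.1, (enum_val j).2))).

Lemma big_index (R : nmodType) (B : 'I_#|{: J}| -> R) :
  \sum_j B j = \sum_u \sum_l \sum_b B (enum_rank ((u, l, b) : J)).
Proof.
rewrite (reindex (enum_rank : J -> _)); last first.
  by exists enum_val => x _; rewrite ?enum_valK ?enum_rankK.
rewrite pair_bigA pair_bigA.
by apply: eq_bigr => -[[u l] b] _.
Qed.

Lemma evals_mul v : evals (f *m v) = evals v *m mul_evals.
Proof.
apply/rowP => j; rewrite [RHS]mxE big_index evals_coef [X in leval _ _ X]mxE.
rewrite raddf_sum /= (bigD1 (enum_val j).1.1)//= [X in _ + X]big1 ?addr0.
  apply: eq_bigr => l _.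
  rewrite (bigD1 (enum_val j).2)//= [X in _ + X]big1 ?addr0.
    rewrite [X in _ = _ * X]mxE [X in _ = X * _]evals_coef !enum_rankK /=.
    rewrite eqxx mulr1n levalM; first exact: mulrC.
    by move=> i; apply: tpt_neq0.
  move=> a aj; rewrite [X in _ * X]mxE enum_rankK /= xpair_eqE (negPf aj) andbF.
  by rewrite mulr0.
move=> k kj; rewrite big1// => l _; rewrite big1// => a _.
by rewrite [X in _ * X]mxE enum_rankK /= xpair_eqE (negPf kj) mulr0.
Qed.

Lemma eval_mxE :
  map_mx intr (mul_coords n' e co f) *m eval_mx = eval_mx *m mul_evals.
Proof.
apply/row_matrixP => i; rewrite !row_mul.
have -> : row i eval_mx = evals (jgen (enum_val i)).
  by apply/rowP => j; rewrite 2!mxE.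
rewrite -evals_mul -evalsE; congr (_ *m _).
by apply/rowP => j; rewrite 4!mxE.
Qed.

Lemma det_mul_evals :
  \det mul_evals = \prod_u \prod_(b : G) leval (tau u) (tpt w b) (\det f).
Proof.
pose h (j : J) := ((j.1.1, j.2), j.1.2).
rewrite (@det_block _ _ ('I_r * G)%type s h
    (fun ub => (map_mx (leval (tau ub.1) (tpt w ub.2)) f)^T)).
- rewrite pair_bigA; apply: eq_bigr => -[u b] _ /=.
  by rewrite det_tr leval_det// => i; apply: tpt_neq0.
- exists (fun x => (x.1.1, x.2, x.1.2)); first by case=> [[]].
  by case=> [[]].
- move=> [[u l] b] [[u' l'] b']; rewrite mxE !enum_rankK /= 2!mxE.
  by rewrite !xpair_eqE; case: eqVneq => [<-|]//; case: eqVneq => [<-|].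
Qed.

Lemma eval_mx_unit : eval_mx \in unitmx.
Proof.
pose E' := invmx (\matrix_(k, u) tau u (e k)).
pose W' : 'M[F]_#|{: J}| := \matrix_(i, j)
  (E' (enum_val i).1.1 (enum_val j).1.1 *
   (n%:R ^- d * monom_val (tpt w (enum_val i).2) (- lft (enum_val j).2)) *+
     ((enum_val i).1.2 == (enum_val j).1.2)).
suff /mulmx1_unit[//] : eval_mx *m W' = 1%:M.
apply/matrixP => i j; rewrite [LHS]mxE big_index [RHS]mxE.
rewrite -(inj_eq enum_val_inj).
under eq_bigr do under eq_bigr do under eq_bigr do
  rewrite mxE [W' _ _]mxE evals_coef !enum_rankK gen_coef /=.
case: (enum_val i) (enum_val j) => [[k l] a] [[k' l'] a'] /=.
transitivity (\sum_u \sum_l0 \sum_(b : G)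
   ((tau u (e k) * E' u k') * ((l0 == l)%:R * (l0 == l')%:R) *
    (n%:R ^- d * monom_val (tpt w b) (lft a - lft a')))).
  apply: eq_bigr => u _; apply: eq_bigr => l0 _; apply: eq_bigr => b _.
  case: eqVneq => _; last by rewrite raddf0 !mul0r !mulr0 mul0r.
  case: eqVneq => _; last by rewrite !mulr0 mul0r.
  rewrite levalU monom_valD; last by move=> x; apply: tpt_neq0.
  rewrite !mulr1 mulr1n -!mulrA; congr (_ * _).
  by rewrite [LHS]mulrCA; congr (_ * _); rewrite [LHS]mulrCA.
under eq_bigr do under eq_bigr do rewrite -mulr_sumr.
under eq_bigr do rewrite -mulr_suml -mulr_sumr.
rewrite -mulr_suml -mulr_suml.
have -> : \sum_u tau u (e k) * E' u k' = (k == k')%:R.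
  have /matrixP/(_ k k') := mulmxV tau_unit; rewrite mxE [RHS]mxE => <-.
  by apply: eq_bigr => u _; rewrite [X in _ = X * _]mxE.
have -> : \sum_(l0 < s) (l0 == l)%:R * (l0 == l')%:R = (l == l')%:R :> F.
  rewrite (bigD1 l)//= eqxx mul1r big1 ?addr0// => l0 /negPf ->.
  by rewrite mul0r.
have -> : \sum_(b : G) n%:R ^- d * monom_val (tpt w b) (lft a - lft a') =
    (a == a')%:R.
  rewrite -mulr_sumr (sum_tpt w_prim) mulrnAr mulVf ?expf_neq0//.
  by rewrite res_eq subr0 -res_eq !lftK.
by rewrite -!natrM !mulnb !xpair_eqE.
Qed.

Lemma det_mul_coords : (\det (mul_coords n' e co f))%:~R =
  \prod_u \prod_(b : G) leval (tau u) (tpt w b) (\det f).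
Proof.
rewrite -det_mul_evals -det_map_mx.
have detW : \det eval_mx != 0 by rewrite -unitfE -unitmxE eval_mx_unit.
apply: (mulIf detW); rewrite -!det_mulmx eval_mxE !det_mulmx.
exact: mulrC.
Qed.

End Diagonalization.

(** * Counting characters *)

Section ClosedField.
Variable F : fieldType.
Hypothesis ax : GRing.closed_field_axiom F.

Definition closed_copy : Type := F.
HB.instance Definition _ := GRing.Field.on closed_copy.
HB.instance Definition _ := closed_field.Field_isAlgClosed.Build closed_copy ax.

Lemma closed_field_split (p : {poly F}) :
  {r : seq F | p = lead_coef p *: \prod_(a <- r) ('X - a%:P)}.
Proof. exact: (@closed_field_poly_normal closed_copy p). Qed.

End ClosedField.

Lemma closed_prim_root (F : fieldType) n : GRing.closed_field_axiom F ->
  n%:R != 0 :> F -> exists w : F, n.-primitive_root w.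
Proof.
move=> ax nF; have n_gt0 : (0 < n)%N.
  by rewrite lt0n; apply: contraNneq nF => ->.
pose p : {poly F} := 'X^n - 1; have [r Dp] := closed_field_split ax p.
rewrite (monicP _) ?monicXnsubC // scale1r in Dp.
have rn1: all n.-unity_root r by apply/allP=> z; rewrite -root_prod_XsubC -Dp.
have sz_r: (n < (size r).+1)%N.
  by rewrite -(size_prod_XsubC r id) -Dp size_XnsubC.
have [|z _ zP] := hasP (has_prim_root n_gt0 rn1 _ sz_r); last by exists z.
by rewrite -separable_prod_XsubC -Dp separable_Xn_sub_1.
Qed.

Lemma card_eq_inj_image (T : finType) (U : Type) (S : {set T}) (h : T -> U)
    (A : set U) :
  {in S &, injective h} -> (forall u, A u <-> exists2 x, x \in S & u = h x) ->
  (A #= `I_#|S|)%card.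
Proof.
move=> hI AE.
have -> : A = [set h (enum_val i) | i in [set: 'I_#|S|]].
  apply/seteqP; split=> [u /AE[x xS ->]|_ [i _ <-]].
    by exists (enum_rank_in xS x) => //; rewrite enum_rankK_in.
  by apply/AE; exists (enum_val i) => //; apply: enum_valP.
apply: (@card_eq_trans _ _ _ _ [set: 'I_#|S|]).
  apply: inj_card_eq => i j _ _ /hI E; apply/enum_val_inj/E; exact: enum_valP.
have -> : `I_#|S| = [set val i | i in [set: 'I_#|S|]].
  apply/seteqP; split=> [k kS|_ [i _ <-]]; last exact: ltn_ord.
  by exists (Ordinal (kS : (k < _)%N)).
by apply: card_esym; apply: inj_card_eq => i j _ _; apply: val_inj.
Qed.

Section Characters.
Variables (R : realType) (M : zmodType).
Implicit Types (chi : pontryagin_dual R M) (x y : M).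

Lemma char_ext chi chi' : chi =1 chi' -> chi = chi'.
Proof.
case: chi chi' => [u uD u1] [v vD v1] /= /funext uv.
case: v / uv vD v1 => vD v1.
by congr PontryaginDual; apply: Prop_irrelevance.
Qed.

Lemma char_neq0 chi x : chi x != 0.
Proof. by rewrite -normr_eq0 char_norm oner_neq0. Qed.

Lemma char0 chi : chi 0 = 1.
Proof. by apply: (mulfI (char_neq0 chi 0)); rewrite -char_valD addr0 mulr1. Qed.

Lemma charB chi x y : chi (x - y) = chi x / chi y.
Proof.
apply: (mulIf (char_neq0 chi y)); rewrite -char_valD subrK mulfVK//.
exact: char_neq0.
Qed.

Lemma char_sum chi (I : Type) (s : seq I) (P : pred I) (B : I -> M) :
  chi (\sum_(i <- s | P i) B i) = \prod_(i <- s | P i) chi (B i).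
Proof. by apply: big_morph => [x y|]; rewrite ?char0 ?char_valD. Qed.

Lemma charMz chi x (m : int) : chi (x *~ m) = chi x ^ m.
Proof.
have E (k : nat) : chi (x *+ k) = chi x ^+ k.
  by elim: k => [|k IH]; rewrite ?mulr0n ?char0// mulrS char_valD IH exprS.
case: m => k; first exact: E.
by rewrite NegzE mulrNz -sub0r charB char0 div1r -exprnN -E.
Qed.

End Characters.

Section CountCharacters.
Variables (R : realType) (N : nat) (Phi : 'M[int]_N).
Hypothesis det_neq0 : \det Phi != 0.

Lemma card_kernel_characters :
  ([set psi : pontryagin_dual R 'rV[int]_N | forall x, psi (x *m Phi) = 1%R] #=
     `I_`|\det Phi|%N)%card.
Proof.
have [L Lu [Q Qu [dl _ PhiE]]] := int_Smith_normal_form Phi.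
pose D : 'M[int]_N := \matrix_(i, j) (dl`_i *+ (i == j :> nat)).
pose m (i : 'I_N) := `|(dl`_i)%R|%N.
have detE : `|\det Phi|%N = (\prod_i m i)%N.
  have detD : \det D = \prod_(i < N) dl`_i.
    rewrite det_trig; first by apply: eq_bigr => i _; rewrite mxE eqxx.
    by apply/is_trig_mxP => i j ij; rewrite mxE (ltn_eqF ij).
  have unit1 (B : 'M[int]_N) : B \in unitmx -> `|\det B|%N = 1%N.
    by rewrite unitmxE qualifE /= => /orP[] /eqP ->.
  rewrite PhiE !det_mulmx !abszM (unit1 L Lu) (unit1 Q Qu) mul1n muln1 detD.
  by apply: (big_morph absz abszM).
have m_gt0 i : (0 < m i)%N.
  move: det_neq0; rewrite -absz_gt0 detE lt0n; apply: contraNT.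
  by rewrite -eqn0Ngt => /eqP mi; apply/eqP; rewrite (bigD1 i)//= mi.
have /choice[w w_prim] : forall i, exists w : R[i], (m i).-primitive_root w.
  move=> i; apply: closed_prim_root; first exact: solve_monicpoly.
  by rewrite pnatr_eq0 -lt0n.
have w_norm i : `|w i| = 1.
  have /eqP := congr1 Num.norm (prim_expr_order (w_prim i)).
  by rewrite normrX normr1 pexpr_eq1// => /eqP.
pose M := (\prod_i m i)%N.
pose S : {set {ffun 'I_N -> 'I_M.+1}} :=
  [set g in family (fun i => [pred k : 'I_M.+1 | k < m i]%N)].
have mM i : (m i <= M.+1)%N.
  by rewrite leqW// /M (bigD1 i)//= leq_pmulr// prodn_gt0.
have cardS : #|S| = `|\det Phi|%N.
  rewrite cardsE card_family detE foldrE big_image /=.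
  apply: eq_bigr => i _; rewrite -sum1_card.
  by rewrite -(big_ord_widen _ (fun=> 1%N) (mM i)) sum1_card card_ord.
pose Psi_val (g : {ffun 'I_N -> 'I_M.+1}) (x : 'rV[int]_N) : R[i] :=
  \prod_i (w i ^+ g i) ^ ((x *m invmx Q) 0 i).
have PsiD g x y : Psi_val g (x + y) = Psi_val g x * Psi_val g y.
  rewrite -big_split; apply: eq_bigr => i _; rewrite mulmxDl mxE expfzDr//.
  by rewrite expf_neq0// -normr_eq0 w_norm oner_neq0.
have Psi1 g x : `|Psi_val g x| = 1.
  rewrite normr_prod big1// => i _.
  case: (_ 0 i) => k; first by rewrite !normrX w_norm !expr1n.
  by rewrite NegzE -exprnN normfV !normrX w_norm !expr1n invr1.
pose Psi g := PontryaginDual (PsiD g) (Psi1 g).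
have Psi_row g i : Psi g (row i Q) = w i ^+ g i.
  rewrite /= /Psi_val rowE -mulmxA mulmxV// mulmx1 (bigD1 i)//=.
  rewrite mxE !eqxx expr1z big1 ?mulr1// => j ji.
  by rewrite mxE eqxx (negPf ji) expr0z.
have char_row (psi : pontryagin_dual R 'rV[int]_N) x :
    psi x = \prod_i psi (row i Q) ^ ((x *m invmx Q) 0 i).
  rewrite -{1}[x]mulmx1 -(mulVmx Qu) mulmxA [x *m _ in LHS]row_sum_delta.
  rewrite mulmx_suml char_sum; apply: eq_bigr => i _.
  by rewrite -scalemxAl -rowE -{1}[(x *m _) 0 i]intz scaler_int charMz.
have kerP (psi : pontryagin_dual R 'rV[int]_N) :
    (forall x, psi (x *m Phi) = 1) <-> forall i, psi (row i Q) ^+ m i = 1.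
  have rowE i y : (y *m D) 0 i = y 0 i * dl`_i.
    rewrite mxE (bigD1 i)//= mxE eqxx big1 ?addr0// => j /negPf ji.
    by rewrite mxE val_eqE ji mulr0.
  have powE i : (psi (row i Q) ^+ m i == 1) = (psi (row i Q) ^ dl`_i == 1).
    rewrite /m; case: (dl`_i) => k //.
    by rewrite NegzE abszN -exprnN invr_eq1.
  have PhiQ y : psi (y *m (D *m Q)) = \prod_i psi (row i Q) ^ ((y *m D) 0 i).
    by rewrite char_row; apply: eq_bigr => i _; rewrite mulmxA mulmxK.
  split=> [h i|h x].
    apply/eqP; rewrite powE -(h (delta_mx 0 i *m invmx L)) PhiE.
    rewrite !mulmxA mulmxKV// -mulmxA PhiQ (bigD1 i)//= big1 ?mulr1.
      by rewrite rowE mxE !eqxx mul1r.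
    by move=> j ji; rewrite rowE mxE (negPf ji) andbF mul0r expr0z.
  rewrite PhiE -mulmxA mulmxA PhiQ big1// => i _.
  rewrite rowE mulrC -exprz_exp.
  have /eqP := h i; rewrite powE => /eqP ->.
  by rewrite exp1rz.
rewrite -cardS; apply: (card_eq_inj_image (h := Psi)).
  move=> g g'; rewrite !inE => /familyP gS /familyP gS' E.
  apply/ffunP => i; apply/val_inj/eqP.
  have /eqP := congr1 (fun psi : pontryagin_dual R _ => psi (row i Q)) E.
  rewrite !Psi_row (eq_prim_root_expr (w_prim i)).
  by rewrite !modn_small//; [apply: gS'|apply: gS].
move=> psi; rewrite /= kerP; split=> [h|[g _ ->] i]; last first.
  by rewrite Psi_row -exprM mulnC exprM (prim_expr_order (w_prim i)) expr1n.
have /choice[g gE] i : exists k, psi (row i Q) = w i ^+ k /\ (k < m i)%N.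
  by have [k kE] := prim_rootP (w_prim i) (h i); exists k.
have gM i : (g i < M.+1)%N by apply: leq_trans (mM i); case: (gE i).
exists [ffun i => inord (g i)].
  rewrite inE; apply/familyP => i; rewrite ffunE inE inordK//.
  by case: (gE i).
apply: char_ext => x; rewrite (char_row psi) (char_row (Psi _)).
by apply: eq_bigr => i _; rewrite Psi_row ffunE inordK//; case: (gE i) => ->.
Qed.

End CountCharacters.

Section FixedCharacters.
Variables (R : realType) (A : comNzRingType) (r d s n' : nat).
Variables (e : 'I_r -> A) (co : 'I_r -> {additive A -> int}).
Hypothesis coE : forall a, a = \sum_k e k *~ co k a.
Hypothesis co_e : forall k l, co k (e l) = (k == l)%:R.
Variable f : 'M[laurent d A]_s.

Local Notation n := n'.+1.
Local Notation J := ('I_r * 'I_s * {ffun 'I_d -> 'I_n})%type.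
Local Notation res := (res n').
Local Notation V := 'cV[laurent d A]_s.
Local Notation coords := (@coords A r d s n' co).
Local Notation combi := (@combi A r d s n' e).
Local Notation X := (Xdual R f).
Local Notation Phi := (mul_coords n' e co f).
Local Notation dualZ := (pontryagin_dual R 'rV[int]_#|{: J}|).
Local Notation pi := (fun v : V =>
  (\pi_({ideal_quot (image_submod f)})%qT v : coker_mx f)).

Lemma piD v w : pi (v + w) = pi v + pi w.
Proof. exact: raddfD. Qed.

Lemma piB v w : pi (v - w) = pi v - pi w.
Proof. exact: raddfB. Qed.

Lemma pi_repr (x : coker_mx f) : exists v, pi v = x.
Proof. by exists (repr (x : {ideal_quot (image_submod f)})); apply: reprK. Qed.

Lemma pi_eq v w : pi v = pi w <-> exists u, v - w = f *m u.
Proof.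
split=> [/eqP|[u uE]].
  by rewrite -Quotient.idealrBE => /asboolP.
by apply/eqP; rewrite -Quotient.idealrBE; apply/asboolP; exists u.
Qed.

Lemma coker_actE mu v : coker_act mu (pi v) = pi (shift mu v).
Proof. by rewrite -shiftE; exact: coker_act_pi. Qed.

Lemma restrict_valD (chi : X) x y :
  chi (pi (combi (x + y))) = chi (pi (combi x)) * chi (pi (combi y)).
Proof. by rewrite raddfD piD char_valD. Qed.

Definition restrict (chi : X) : dualZ :=
  PontryaginDual (restrict_valD chi) (fun x => char_norm chi (pi (combi x))).

Lemma Fix_combi (chi : X) v : Fix (@Xdual_act R A d s f) n chi ->
  chi (pi v) = chi (pi (combi (coords v))).
Proof.
move=> chi_fix; elim/(@gen_ind A r d s e co coE): v => [|v w IHv IHw|k i nu].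
- by rewrite !raddf0.
- rewrite piB [LHS]charB IHv IHw [coords (_ - _)]coordsB [combi (_ - _)]combiB.
  by rewrite [X in _ = chi X]piB [RHS]charB.
rewrite (coords_gen _ co_e) combi_delta /jgen /=.
rewrite -[in LHS](subrK (lft (res nu)) nu) -shift_gen -coker_actE.
rewrite -{2}(chi_fix (nu - lft (res nu))); first by [].
move=> i0; have /eqP := resK n' nu; rewrite eq_sym res_eq.
by move=> /forallP/(_ i0); rewrite -[0]/(ord0 : 'I_1).
Qed.

Lemma restrict_inj : {in [set chi | Fix (@Xdual_act R A d s f) n chi] &,
  injective restrict}.
Proof.
move=> chi chi'; rewrite !inE /= => fx fx' E; apply: char_ext => x.
have [v <-] := pi_repr x; rewrite (Fix_combi _ fx) (Fix_combi _ fx').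
exact: (congr1 (fun psi : dualZ => psi (coords v)) E).
Qed.

Lemma restrict_image : [set restrict chi | chi in
    [set chi | Fix (@Xdual_act R A d s f) n chi]] =
  [set psi : dualZ | forall x, psi (x *m Phi) = 1].
Proof.
apply/seteqP; split=> [_ [chi fx <-] x /=|psi psi1].
  rewrite -[x](@combiK A r d s n' e co co_e).
  rewrite -(@coords_mul A r d s n' e co coE co_e).
  rewrite -(Fix_combi _ fx).
  have -> : pi (f *m combi x) = 0; last exact: char0.
  rewrite -(raddf0 (\pi_({ideal_quot (image_submod f)})%qT)).
  by apply/pi_eq; exists (combi x); rewrite subr0.
have psiE v w : pi v = pi w -> psi (coords v) = psi (coords w).
  move=> /pi_eq[u uE].
  rewrite -[v](subrK w) uE [coords (_ + _)]raddfD /= char_valD.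
  by rewrite (@coords_mul A r d s n' e co coE co_e) psi1 mul1r.
pose chi_val (x : coker_mx f) : complex R :=
  psi (coords (repr (x : {ideal_quot (image_submod f)}))).
have chiE v : chi_val (pi v) = psi (coords v) by apply: psiE; apply: reprK.
have chiD x y : chi_val (x + y) = chi_val x * chi_val y.
  have [v <-] := pi_repr x; have [w <-] := pi_repr y.
  by rewrite -piD !chiE -char_valD [coords (_ + _)]raddfD.
pose chi : X := PontryaginDual chiD (fun x => char_norm psi _).
exists chi; last first.
  apply: char_ext => x /=; rewrite chiE.
  by rewrite (@combiK A r d s n' e co co_e).
move=> mu mu0; apply: char_ext => x /=.
have [v <-] := pi_repr x; rewrite coker_actE !chiE.
rewrite (@coords_shift A r d s n' e co coE co_e)//.
by apply/eqP; rewrite res_eq subr0; apply/forallP => i; apply: mu0.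
Qed.

Lemma card_Fix : \det Phi != 0 ->
  (Fix (@Xdual_act R A d s f) n #= `I_`|\det Phi|%N)%card.
Proof.
move=> det0; apply: card_eq_trans (card_kernel_characters R det0).
rewrite -restrict_image card_eq_sym; apply: inj_card_eq.
exact: restrict_inj.
Qed.

End FixedCharacters.

(** * Integral basis and embeddings of a number field *)

Lemma rat_integral_int (F : numFieldType) (q : rat) :
  integralOver (intr : int -> F) (ratr q) -> exists m : int, q = m%:~R.
Proof.
case=> p p_monic.
have pE (L : numFieldType) :
    map_poly (intr : int -> L) p = map_poly ratr (map_poly intr p : {poly rat}).
  by rewrite -map_poly_comp; apply: eq_map_poly => m /=; rewrite ratr_int.
rewrite pE fmorph_root -(fmorph_root (ratr : rat -> algC)) -pE => pq.
have /Cint_rat_Aint/(_ _)/intrP[] : (ratr q : algC) \in Crat.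
  by apply/CratP; exists q.
  apply: root_monic_Aint pq _ _; first exact: monic_map.
  by apply/polyOverP => i; rewrite coef_map /= intr_int.
move=> m /eqP; rewrite -(ratr_int algC) (inj_eq (fmorph_inj _)) => /eqP.
by exists m.
Qed.

Lemma intrK_inj (K : fieldExtType rat) : injective (intr : int -> K).
Proof.
move=> m m'; rewrite -!(rmorph_int (in_alg K)) => /fmorph_inj.
exact: intr_inj.
Qed.

Lemma num_field_pchar (K : fieldExtType rat) : [pchar K] =i pred0.
Proof.
move=> l; rewrite inE; apply/negbTE/negP => /andP[lp].
rewrite -(rmorph_nat (in_alg K)) fmorph_eq0 pnatr_eq0 => /eqP l0.
by rewrite l0 in lp.
Qed.

Lemma integral_multiple (K : fieldExtType rat) (x : K) :
  exists2 a : int, a != 0 & integralOver (intr : int -> K) (a%:~R * x).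
Proof.
have /polyOver1P[p pE] := minPolyOver 1%AS x.
have [q [b b0 pq]] := rat_poly_scale p.
have qx : (map_poly (intr : int -> K) q).[x] = 0.
  have := minPolyxx 1%AS x; rewrite pE pq map_polyZ hornerZ => /eqP.
  rewrite mulf_eq0 fmorph_eq0 invr_eq0 intr_eq0 (negPf b0) /= => /eqP <-.
  congr (_.[_]); rewrite -map_poly_comp; apply: eq_map_poly => m /=.
  by rewrite scaler_int.
have sq : size q = (adjoin_degree 1%AS x).+1.
  rewrite -(size_minPoly 1%AS x) pE size_map_poly pq.
  rewrite size_scale ?invr_eq0 ?intr_eq0//.
  by rewrite size_map_inj_poly//; apply: intr_inj.
have q0 : q != 0 by rewrite -size_poly_gt0 sq.
exists (lead_coef q); first by rewrite lead_coef_eq0.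
move: sq; set n := adjoin_degree _ _ => sq; have n_gt0 : (0 < n)%N by [].
clearbody n.
pose a := lead_coef q; have aE : q`_n = a by rewrite /a lead_coefE sq.
pose h := \poly_(i < n.+1) (if i == n then 1 else q`_i * a ^+ (n.-1 - i)).
have hn : h`_n = 1 by rewrite coef_poly ltnSn eqxx.
have sh : size h = n.+1 by rewrite size_poly_eq// eqxx oner_neq0.
exists h; first by rewrite monicE lead_coefE sh hn.
apply/rootP; rewrite -[RHS](mulr0 (a%:~R ^+ n.-1)) -qx.
have szE q' : size (map_poly (intr : int -> K) q') = size q'.
  exact: (size_map_inj_poly (@intrK_inj K) (mulr0z 1)).
rewrite !(@horner_coef_wide _ n.+1) ?szE ?sh ?sq//.
rewrite mulr_sumr; apply: eq_bigr => i _.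
rewrite !coef_map /= coef_poly ltn_ord.
rewrite exprMn; case: eqP => [->|/eqP ni].
  by rewrite aE !mulrA mul1r -exprSr prednK.
have {ni} lin : (i < n)%N by rewrite ltn_neqAle ni -ltnS ltn_ord.
have -> : a%:~R ^+ n.-1 = a%:~R ^+ (n.-1 - i) * a%:~R ^+ i :> K.
  by rewrite -exprD subnK// -ltnS prednK.
rewrite rmorphM rmorphXn /=; set A := _ ^+ (_ - _); set B := _ ^+ i.
by rewrite !mulrA [A * B * _]mulrC -!mulrA; congr (_ * _); rewrite mulrA.
Qed.

Section Embeddings.
Variables (K : fieldExtType rat) (C : numClosedFieldType) (th : K).
Hypothesis th_gen : (fullv : {vspace K}) = <<1; th>>%VS.
Variable p0 : {poly rat}.
Hypothesis p0E : minPoly 1%AS th = map_poly (in_alg K) p0.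

Local Notation r := (size p0).-1.
Local Notation evK q := (map_poly (in_alg K) q).[th].
Local Notation evC q x := (map_poly (ratr : rat -> C) q).[x].

Lemma size_p0 : size p0 = r.+1.
Proof. by rewrite prednK// -(size_map_poly (in_alg K)) -p0E size_minPoly. Qed.

Lemma ev_eq0 q : evK q = 0 -> p0 %| q.
Proof.
move=> q0; rewrite -(dvdp_map (in_alg K)) -p0E minPoly_dvdp//.
  by apply/polyOver1P; exists q.
exact/rootP.
Qed.

Lemma small_poly_exists (y : K) :
  exists q : {poly rat}, (size q <= r)%N /\ evK q = y.
Proof.
have yK : y \in <<1; th>>%VS by rewrite -th_gen memvf.
have /polyOver1P[q qE] := Fadjoin_polyOver 1%AS th y.
exists q; rewrite -qE Fadjoin_poly_eq//; split=> //.
rewrite -(size_map_poly (in_alg K)) -qE (leq_trans (size_Fadjoin_poly _ _ _))//.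
by rewrite -ltnS -size_p0 -(size_map_poly (in_alg K)) -p0E size_minPoly.
Qed.

Definition small_poly y := projT1 (cid (small_poly_exists y)).

Lemma size_small_poly y : (size (small_poly y) <= r)%N.
Proof. by rewrite /small_poly; case: cid => q []. Qed.

Lemma small_polyK y : evK (small_poly y) = y.
Proof. by rewrite /small_poly; case: cid => q []. Qed.

Lemma small_poly_eq (q q' : {poly rat}) : (size q <= r)%N -> (size q' <= r)%N ->
  evK q = evK q' -> q = q'.
Proof.
move=> sq sq' E; apply/eqP; rewrite -subr_eq0; apply/negPn/negP => qq'.
have /dvdp_leq : p0 %| q - q'.
  by apply: ev_eq0; rewrite rmorphB hornerD hornerN E subrr.
move=> /(_ qq'); apply/negP; rewrite -ltnNge size_p0 ltnS.
by rewrite (leq_trans (size_polyD _ _))// size_polyN geq_max sq.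
Qed.

Section Root.
Variable x : C.
Hypothesis x_root : root (map_poly ratr p0) x.

Definition embed (y : K) : C := evC (small_poly y) x.

Lemma embedE q : embed (evK q) = evC q x.
Proof.
have /dvdpP[q' q'E] : p0 %| small_poly (evK q) - q.
  by apply: ev_eq0; rewrite rmorphB hornerD hornerN small_polyK subrr.
apply/eqP; rewrite -subr_eq0 -hornerN -hornerD -rmorphB q'E rmorphM hornerM.
by rewrite (rootP x_root) mulr0.
Qed.

Lemma embed_zmod : zmod_morphism embed.
Proof.
move=> y z; rewrite -[y]small_polyK -[z]small_polyK.
by rewrite -hornerN -hornerD -rmorphB !embedE rmorphB hornerD hornerN.
Qed.

Lemma embed_monoid : monoid_morphism embed.
Proof.
split.
  have <- : evK 1 = 1 by rewrite rmorph1 hornerC.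
  by rewrite embedE rmorph1 hornerC.
move=> y z; rewrite -[y]small_polyK -[z]small_polyK.
by rewrite -hornerM -rmorphM !embedE rmorphM hornerM.
Qed.

HB.instance Definition _ := GRing.isZmodMorphism.Build K C embed embed_zmod.
HB.instance Definition _ := GRing.isMonoidMorphism.Build K C embed embed_monoid.

Definition embedding : {rmorphism K -> C} := embed.

End Root.

Lemma rmorph_ev (t : {rmorphism K -> C}) q : t (evK q) = evC q (t th).
Proof.
rewrite -horner_map -map_poly_comp; congr (_.[_]); apply: eq_map_poly => a /=.
exact: (fmorph_eq_rat (t \o in_alg K)).
Qed.

Lemma rmorph_root (t : {rmorphism K -> C}) : root (map_poly ratr p0) (t th).
Proof. by apply/rootP; rewrite -rmorph_ev -p0E minPolyxx rmorph0. Qed.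

Lemma p0_roots : {x : r.-tuple C | uniq x &
  forall z, root (map_poly ratr p0) z = (z \in x)}.
Proof.
have [xs xsE] := closed_field_poly_normal (map_poly (ratr : rat -> C) p0).
have lc : lead_coef (map_poly ratr p0) != 0 :> C.
  by rewrite lead_coef_eq0 map_poly_eq0 -size_poly_eq0 size_p0.
have rP z : root (map_poly ratr p0) z = (z \in xs).
  by rewrite xsE rootZ// root_prod_XsubC.
have uxs : uniq xs.
  rewrite -separable_prod_XsubC.
  rewrite -(eqp_separable (eqp_scale _ lc)) -xsE separable_map.
  rewrite -(separable_map (in_alg K)) -p0E.
  by apply: pcharf0_separable; apply: num_field_pchar.
have sxs : size xs == r.
  rewrite -eqSS -size_p0 -(size_map_poly (ratr : rat -> C)) xsE size_scale//.
  by rewrite size_prod_XsubC.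
by exists (Tuple sxs).
Qed.

End Embeddings.

Section LatticeBasis.
Variables (O : zmodType) (r : nat) (Lc : {additive O -> 'rV[int]_r}).

Local Notation family_mx b := (\matrix_k Lc (b k)).

Lemma mulmx_int_inj (M : 'M[int]_r) : \det M != 0 ->
  injective (fun t : 'rV[int]_r => t *m M).
Proof.
move=> M0 t t' /(congr1 (mulmx^~ (\adj M))) /=.
rewrite -!mulmxA mul_mx_adj !mul_mx_scalar => /rowP E; apply/rowP => i.
by apply: (mulfI M0); have := E i; rewrite !mxE.
Qed.

(* A family of minimal nonzero |det| is a basis: otherwise Cramer's rule and a
   Euclidean division would produce a family of smaller determinant. *)
Lemma lattice_generators : (exists b : 'I_r -> O, \det (family_mx b) != 0) ->
  exists2 b : 'I_r -> O, \det (family_mx b) != 0 &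
    forall y, exists t : 'rV[int]_r, Lc y = t *m family_mx b.
Proof.
move=> [b0 b0_det].
pose Q (m : nat) := `[< exists2 b : 'I_r -> O, \det (family_mx b) != 0 &
   `|\det (family_mx b)|%N = m >].
have exQ : exists m, Q m.
  by exists `|\det (family_mx b0)|%N; apply/asboolP; exists b0.
case: (ex_minnP exQ) => m /asboolP[b b_det b_m] m_min; exists b => // y.
set M := family_mx b in b_det b_m *.
pose t := Lc y *m \adj M.
have dvd_t i : (\det M %| t 0%R i)%Z.
  pose b' k := if k == i then y - b i *~ (t 0%R i %/ \det M)%Z else b k.
  have detb' : \det (family_mx b') = (t 0%R i %% \det M)%Z.
    pose My := \matrix_k (if k == i then Lc y else Lc (b k)).
    have -> : \det (family_mx b') =
        1 * \det My - (t 0%R i %/ \det M)%Z * \det M.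
      rewrite -mulNr; apply: (determinant_multilinear (i0 := i)).
      - rewrite !rowK eqxx /b' eqxx scale1r raddfB raddfMz /= -scaler_int.
        by rewrite scaleNr; congr (_ - _ *: _); rewrite intz.
      - apply/matrixP => k l; rewrite !mxE /b' eq_sym.
        by rewrite (negPf (neq_lift i k)).
      - apply/matrixP => k l; rewrite !mxE /b' eq_sym.
        by rewrite (negPf (neq_lift i k)).
    rewrite mul1r; suff -> : \det My = t 0%R i.
      by rewrite [X in X - _](divz_eq _ (\det M)) addrC addKr.
    rewrite (expand_det_row _ i) mxE; apply: eq_bigr => k _.
    rewrite !mxE eqxx; congr (_ * _); rewrite /cofactor; congr (_ * \det _).
    by apply/matrixP => u v; rewrite !mxE eq_sym (negPf (neq_lift i u)).
  apply/negPn/negP => ndvd.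
  have : (m <= `|(t 0%R i %% \det M)%Z|)%N.
    apply: m_min; apply/asboolP; exists b'; rewrite detb'//.
    by apply: contraNneq ndvd => /dvdz_mod0P.
  rewrite leqNgt -b_m => /negP; apply.
  by rewrite -ltz_nat !abszE ger0_norm ?modz_ge0// ltz_mod.
exists (\row_i (t 0%R i %/ \det M)%Z).
have : (\det M) *: Lc y = \det M *: (\row_i (t 0%R i %/ \det M)%Z *m M).
  rewrite -mul_mx_scalar -mul_adj_mx mulmxA -/t scalemxAl; congr (_ *m _).
  by apply/rowP => i; rewrite [RHS]mxE [X in _ * X]mxE mulrC divzK.
move=> /rowP E; apply/rowP => i; apply: (mulfI b_det).
by have := E i; rewrite !mxE.
Qed.

End LatticeBasis.

Lemma integral_cofactor (F : fieldType) (D : F) : D != 0 ->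
  integralOver (intr : int -> F) D ->
  exists2 m : int, m != 0 & exists2 t, integralOver (intr : int -> F) t &
    m%:~R = D * t.
Proof.
move=> D0 D_int; have [P P_monic /rootP PD] := D_int.
have [k [q] ] := multiplicity_XsubC P 0; rewrite monic_neq0//= => q0 PE.
have qD : (map_poly (intr : int -> F) q).[D] = 0.
  apply/eqP; move: PD; rewrite PE rmorphM rmorphXn hornerM horner_exp => /eqP.
  rewrite mulf_eq0 expf_eq0 rmorphB /= map_polyX map_polyC !hornerE /=.
  by rewrite mulr0z subr0 (negPf D0) andbF orbF.
have /factor_theorem[q' q'E] : root (q - q.[0]%:P) 0.
  by apply/rootP; rewrite !hornerE subrr.
exists q.[0]; first exact: q0.
exists (- (map_poly (intr : int -> F) q').[D]).
  apply/integral_opp/integral_horner => //; apply/integral_poly => i.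
  by rewrite coef_map; apply: integral_id.
have /eqP := qD; rewrite -[q](subrK q.[0]%:P) q'E rmorphD rmorphM rmorphB /=.
rewrite map_polyX !map_polyC /= !hornerE mulr0z subr0 addrC addr_eq0 => /eqP ->.
by rewrite mulrN mulrC.
Qed.

Definition integral_pred (F : fieldType) : pred F :=
  fun x => `[< integralOver (intr : int -> F) x >].

Lemma integral_subring (F : fieldType) : subring_closed (@integral_pred F).
Proof.
split=> [|x y /asboolP xi /asboolP yi|x y /asboolP xi /asboolP yi];
  apply/asboolP; [exact: integral1|exact: integral_sub|exact: integral_mul].
Qed.

HB.instance Definition _ (F : fieldType) :=
  GRing.isSubringClosed.Build F (@integral_pred F) (@integral_subring F).

Lemma integral_det (F : fieldType) n (M : 'M[F]_n) :
  (forall i j, M i j \in @integral_pred F) -> \det M \in @integral_pred F.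
Proof.
move=> Mi; apply: rpred_sum => s _; apply: rpredM; last exact: rpred_prod.
by rewrite rpredX// rpredN1.
Qed.

Lemma rmorph_integral (F1 F2 : fieldType) (t : {rmorphism F1 -> F2}) x :
  x \in @integral_pred F1 -> t x \in @integral_pred F2.
Proof.
move=> /asboolP/(integral_rmorph t)[q q_monic qx].
apply/asboolP; exists q => //.
suff -> : map_poly (intr : int -> F2) q = map_poly (t \o intr) q by [].
by apply: eq_map_poly => m /=; rewrite rmorph_int.
Qed.

Section IntegralBasis.
Variables (K : fieldExtType rat) (C : numClosedFieldType) (th : K).
Hypothesis th_gen : (fullv : {vspace K}) = <<1; th>>%VS.
Hypothesis th_int : th \in @integral_pred K.
Variable p0 : {poly rat}.
Hypothesis p0E : minPoly 1%AS th = map_poly (in_alg K) p0.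
Local Notation r := (size p0).-1.
Variable x : r.-tuple C.
Hypothesis x_uniq : uniq x.
Hypothesis x_root : forall z, root (map_poly ratr p0) z = (z \in x).

Local Notation O := (ring_of_integers K).
Local Notation small_poly := (small_poly th_gen p0E).
Local Notation evK q := (map_poly (in_alg K) q).[th].

Lemma tnth_root u : root (map_poly ratr p0) (tnth x u).
Proof. by rewrite x_root mem_tnth. Qed.

Definition emb (u : 'I_r) : {rmorphism K -> C} :=
  embedding th_gen p0E (tnth_root u).

Definition cvec (y : K) : 'rV[rat]_r := \row_l (small_poly y)`_l.

Lemma cvecB : {morph cvec : y z / y - z}.
Proof.
move=> y z; suff E : small_poly (y - z) = small_poly y - small_poly z.
  by apply/rowP => l; rewrite !mxE E coefB.
apply: (small_poly_eq p0E).
- exact: size_small_poly.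
- rewrite (leq_trans (size_polyD _ _))// size_polyN geq_max.
  by rewrite !size_small_poly.
- by rewrite rmorphB hornerD hornerN !small_polyK.
Qed.

HB.instance Definition _ :=
  GRing.isZmodMorphism.Build K 'rV[rat]_r cvec cvecB.

Lemma cvec_eq0 y : cvec y = 0 -> y = 0.
Proof.
move=> /rowP E; rewrite -(small_polyK th_gen p0E y).
suff -> : small_poly y = 0 by rewrite rmorph0 horner0.
apply/polyP => i; rewrite coef0; have [ir|ri] := ltnP i r.
  by have := E (Ordinal ir); rewrite !mxE.
by rewrite nth_default// (leq_trans (size_small_poly _ _ _)).
Qed.

Lemma cvec_exp (l : 'I_r) : cvec (th ^+ l) = delta_mx 0 l.
Proof.
have -> : th ^+ l = evK 'X^l by rewrite map_polyXn hornerXn.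
apply/rowP => j; rewrite !mxE eqxx /=.
have -> : small_poly (evK 'X^l) = 'X^l.
  apply: (small_poly_eq p0E); rewrite ?size_polyXn ?small_polyK//.
  exact: size_small_poly.
by rewrite coefXn.
Qed.

Definition vdm : 'M[C]_r := Vandermonde r (\row_u tnth x u).

Lemma emb_cvec y : \row_u emb u y = map_mx ratr (cvec y) *m vdm.
Proof.
apply/rowP => u; rewrite !mxE.
rewrite -{1}[y](small_polyK th_gen p0E) [LHS](embedE th_gen p0E (tnth_root u)).
rewrite (@horner_coef_wide _ r); last first.
  by rewrite size_map_poly size_small_poly.
by apply: eq_bigr => l _; rewrite coef_map !mxE.
Qed.

Lemma det_vdm_neq0 : \det vdm != 0.
Proof.
rewrite det_Vandermonde; apply/prodf_neq0 => i _; apply/prodf_neq0 => j ij.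
rewrite !mxE subr_eq0; apply: contraTneq ij => /eqP.
rewrite -[_ == _]/(tnth x j == tnth x i :> C) !(tnth_nth 0).
rewrite nth_uniq ?size_tuple//.
by move=> /eqP /val_inj ->; rewrite ltnn.
Qed.

Lemma emb_th u : emb u th = tnth x u.
Proof.
have thE : th = evK 'X by rewrite map_polyX hornerX.
rewrite [X in emb u X]thE [LHS](embedE th_gen p0E (tnth_root u)).
by rewrite map_polyX hornerX.
Qed.

Lemma vdm_integral i j : vdm i j \in @integral_pred C.
Proof. by rewrite !mxE rpredX// -emb_th rmorph_integral. Qed.

Lemma det_vdm_integral : \det vdm \in @integral_pred C.
Proof. by apply: integral_det => i j; apply: vdm_integral. Qed.

Lemma common_denominator : exists2 a : int, a != 0 & forall y : O,
  exists z : 'rV[int]_r, map_mx intr z = a%:~R *: cvec (val y).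
Proof.
have [a a0 [t t_int aE]] :=
  integral_cofactor det_vdm_neq0 (asboolW det_vdm_integral).
exists a => // y.
suff zE l : exists m : int, a%:~R * cvec (val y) 0 l = m%:~R.
  have /choice[z zlE] := zE.
  by exists (\row_l z l); apply/rowP => l; rewrite !mxE -zlE mxE.
apply: (@rat_integral_int C); rewrite rmorphM /= ratr_int aE.
suff : \det vdm * ratr (cvec (val y) 0 l) \in @integral_pred C.
  move=> /asboolP Di; rewrite mulrAC; exact: integral_mul.
have -> : \det vdm * ratr (cvec (val y) 0 l) =
    ((\row_u emb u (val y)) *m \adj vdm) 0 l.
  rewrite emb_cvec -mulmxA mul_mx_adj mul_mx_scalar [RHS]mxE; congr (_ * _).
  by rewrite [RHS]mxE.
rewrite mxE; apply: rpred_sum => u _; apply: rpredM.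
  rewrite mxE; apply: rmorph_integral; exact: (valP y).
rewrite mxE; apply: rpredM; first by rewrite rpredX// rpredN1.
apply: integral_det => i j; rewrite 2!mxE.
exact: vdm_integral.
Qed.

Lemma rmorph_emb (t : {rmorphism K -> C}) : exists u, t =1 emb u.
Proof.
have := rmorph_root p0E t; rewrite x_root => /tnthP[u tu]; exists u => y.
rewrite -[y](small_polyK th_gen p0E) rmorph_ev.
by rewrite [RHS](embedE th_gen p0E (tnth_root u)) tu.
Qed.

Lemma emb_inj u u' : emb u =1 emb u' -> u = u'.
Proof.
move=> /(_ th); rewrite !emb_th !(tnth_nth 0) => /eqP.
by rewrite nth_uniq ?size_tuple// => /eqP/val_inj.
Qed.

Lemma integral_basis_of_generator :
  exists (e : 'I_r -> O) (co : 'I_r -> {additive O -> int}),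
    [/\ forall a, a = \sum_k e k *~ co k a,
        forall k l, co k (e l) = (k == l)%:R &
        \matrix_(k, u) emb u (val (e k)) \in unitmx].
Proof.
have [a a0 /choice[z zE]] := common_denominator.
have intmx_inj : injective (map_mx intr : 'rV[int]_r -> 'rV[rat]_r).
  move=> u v /rowP E; apply/rowP => i.
  by apply: (@intr_inj rat); have := E i; rewrite !mxE.
have zB : zmod_morphism z.
  move=> y y'; apply: intmx_inj.
  rewrite map_mxB !zE (_ : val (y - y') = val y - val y'); last exact: raddfB.
  by rewrite cvecB scalerBr.
pose zM := GRing.isZmodMorphism.Build O 'rV[int]_r z zB.
pose Lc : {additive O -> 'rV[int]_r} := HB.pack z zM.
have thX k : th ^+ k \in alg_int (K := K) by apply: (rpredX k th_int).
have detmx b : map_mx intr (\matrix_k Lc (b k)) =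
    a%:~R *: \matrix_k cvec (val (b k : O)) :> 'M[rat]_r.
  by apply/row_matrixP => k; rewrite -map_row rowK linearZ /= rowK zE.
have [|b b_det b_gen] := @lattice_generators _ _ Lc.
  exists (fun k => RingOfIntegers (thX k)).
  rewrite -(intr_eq0 rat) -det_map_mx detmx detZ.
  rewrite mulf_neq0 ?expf_neq0 ?intr_eq0//.
  rewrite (_ : \matrix_k _ = 1%:M) ?det1 ?oner_neq0//.
  by apply/row_matrixP => k; rewrite rowK cvec_exp row1.
have /choice[t tE] := b_gen.
set M := \matrix_k _ in b_det tE.
have t_inj := mulmx_int_inj b_det.
have tB k : zmod_morphism (fun y => t y 0 k).
  move=> y y'; rewrite (_ : t (y - y') = t y - t y') ?mxE//.
  by apply: t_inj; rewrite mulmxBl -!tE raddfB.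
pose co k : {additive O -> int} :=
  HB.pack (fun y => t y 0 k) (GRing.isZmodMorphism.Build O int _ (tB k)).
exists b, co; split=> [y|k l|].
- apply/eqP; rewrite -subr_eq0; apply/eqP.
  suff Lc0 y' : Lc y' = 0 -> y' = 0.
    apply: Lc0; rewrite raddfB raddf_sum [Lc y]tE mulmx_sum_row -sumrB.
    rewrite big1// => k _.
    by rewrite rowK raddfMz -scaler_int intz subrr.
  move=> y0; apply/val_inj/cvec_eq0; apply: (scalerI (a := a%:~R)).
    by rewrite intr_eq0.
  by rewrite -zE [z y']y0 map_mx0 scaler0.
- rewrite /= (_ : t (b l) = delta_mx 0 l) ?mxE ?eqxx//.
  by apply: t_inj; rewrite -tE -rowE rowK.
pose E := \matrix_(k, u) emb u (val (b k)).
have EE : a%:~R *: E = map_mx intr M *m vdm.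
  apply/row_matrixP => k; rewrite row_mul linearZ /=.
  have -> : row k E = \row_u emb u (val (b k)).
    by apply/rowP => u; rewrite !mxE.
  rewrite emb_cvec -map_row rowK scalemxAl; congr (_ *m _).
  have /(congr1 (map_mx (ratr : rat -> C))) := zE (b k).
  rewrite map_mxZ /= ratr_int => <-; apply/rowP => l.
  by rewrite !mxE ratr_int.
have : \det (a%:~R *: E) != 0.
  by rewrite EE det_mulmx mulf_neq0 ?det_vdm_neq0// det_map_mx intr_eq0.
by rewrite detZ mulf_eq0 negb_or => /andP[_]; rewrite -unitfE -unitmxE.
Qed.

End IntegralBasis.

Lemma integral_primitive_element (K : fieldExtType rat) :
  exists2 th : K, (fullv : {vspace K}) = <<1; th>>%VS & th \in @integral_pred K.
Proof.
have sepK : separable 1 (fullv : {vspace K}).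
  apply/separableP => y _.
  by apply: pcharf0_separable; apply: num_field_pchar.
have := eq_adjoin_separable_generator sepK (subvf _).
set y := separable_generator _ _ => yE.
have [a a0 ay] := integral_multiple y.
exists (a%:~R * y); last exact/asboolP.
apply/eqP; rewrite eqEsubv subvf andbT {1}yE; apply/FadjoinP; split.
  exact: subv_adjoin.
have yE' : y = (a%:~R^-1 : rat) *: (a%:~R * y).
  by rewrite mulrzl -scaler_int scalerA mulVf ?scale1r// intr_eq0.
by rewrite [X in X \in _]yE' memvZ// memv_adjoin.
Qed.

Lemma integral_basis (K : fieldExtType rat) (C : numClosedFieldType) :
  exists r (e : 'I_r -> ring_of_integers K)
      (co : 'I_r -> {additive ring_of_integers K -> int})
      (tau : 'I_r -> {rmorphism K -> C}),
    [/\ forall a, a = \sum_k e k *~ co k a,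
        forall k l, co k (e l) = (k == l)%:R,
        \matrix_(k, u) tau u (val (e k)) \in unitmx,
        forall u u', tau u =1 tau u' -> u = u' &
        forall t : {rmorphism K -> C}, exists u, t =1 tau u].
Proof.
have [th th_gen th_int] := integral_primitive_element K.
have /polyOver1P[p0 p0E] := minPolyOver 1%AS th.
have [x x_uniq x_root] := p0_roots C p0E.
have [e [co [coE co_e E_unit]]] :=
  integral_basis_of_generator th_gen th_int p0E x_uniq x_root.
exists (size p0).-1, e, co, (emb th_gen p0E x_root); split=> //.
  exact: emb_inj.
exact: rmorph_emb.
Qed.

Lemma rmorphism_ext (A B : nzRingType) (t t' : {rmorphism A -> B}) :
  t =1 t' -> t = t'.
Proof.
case: t t' => [f c] [g c'] /= /funext fg; case: g / fg c' => c'.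
congr GRing.RMorphism.Pack; case: c c' => [[u] [v]] [[u'] [v']].
by congr GRing.RMorphism.Class; congr (_ _); apply: Prop_irrelevance.
Qed.

Lemma field_norm_spec (R : realType) (K : fieldExtType rat) d
    (g : laurent d (ring_of_integers K)) :
  field_norm R g != 0 ->
  laurent_map (intr : int -> R[i]) (field_norm R g) = complex_norm R g.
Proof.
rewrite /field_norm; case: xgetP => [G _ //|_]; by rewrite eqxx.
Qed.

Section NormDeterminant.
Variables (R : realType) (K : fieldExtType rat) (d r : nat).
Local Notation O := (ring_of_integers K).
Variables (e : 'I_r -> O) (co : 'I_r -> {additive O -> int}).
Variable tau : 'I_r -> {rmorphism K -> R[i]}.
Hypothesis coE : forall a, a = \sum_k e k *~ co k a.
Hypothesis co_e : forall k l, co k (e l) = (k == l)%:R.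
Hypothesis tau_unit : \matrix_(k, u) tau u (val (e k)) \in unitmx.
Hypothesis tau_inj : forall u u', tau u =1 tau u' -> u = u'.
Hypothesis tau_surj : forall t : {rmorphism K -> R[i]}, exists u, t =1 tau u.

Local Notation tauO u := (tau u \o (val : O -> K) : {rmorphism O -> R[i]}).

Lemma complex_norm_prod (g : laurent d O) :
  complex_norm R g = \prod_u laurent_map (tauO u) g.
Proof.
rewrite /complex_norm.
pose h (u : 'I_r) : {classic {rmorphism K -> R[i]}} := tau u.
rewrite (reindex_fsbig h setT); last first.
  split=> //.
    by move=> u u' _ _ hu; apply: tau_inj => y; rewrite -[tau u]/(h u) hu.
  move=> t _; have [u tu] := tau_surj t; exists u => //.
  by apply: rmorphism_ext => y; rewrite tu.
rewrite (_ : setT = [set` index_enum 'I_r]); last first.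
  by apply/seteqP; split=> // u _ /=; rewrite mem_index_enum.
by rewrite -fsbig_seq// index_enum_uniq.
Qed.

Lemma leval_field_norm (g : laurent d O) (z : 'rV[R[i]]_d) :
  field_norm R g != 0 ->
  (forall i, z 0 i != 0) ->
  leval intr z (field_norm R g) = \prod_u leval (tauO u) z g.
Proof.
move=> /field_norm_spec gE z0; rewrite -(laurent_eval_map intr) gE.
rewrite complex_norm_prod.
have E h : laurent_eval h z = leval idfun z h by [].
rewrite E.
have [phi phiE] := leval_rmorphism (idfun : {rmorphism R[i] -> _}) z0.
rewrite -phiE rmorph_prod; apply: eq_bigr => u _.
by rewrite phiE -E laurent_eval_map.
Qed.

Variables (n' s : nat) (f : 'M[laurent d O]_s).
Hypothesis norm_neq0 : field_norm R (\det f) != 0.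
Local Notation n := n'.+1.
Local Notation F := (field_norm R (\det f)).

Lemma natC_neq0 : n%:R != 0 :> R[i].
Proof. by rewrite pnatr_eq0. Qed.

Lemma det_mul_coords_int (L : fieldType) (w : L) :
  n.-primitive_root w -> n%:R != 0 :> L ->
  (\det (mul_coords n' (fun=> 1 : int)
     (fun _ : 'I_1 => idfun : {additive int -> int}) (F%:M : 'M_1)))%:~R =
  \prod_(b : {ffun 'I_d -> 'I_n}) leval intr (tpt w b) F.
Proof.
move=> w_prim nL.
rewrite (@det_mul_coords int 1 d 1 n' _ _ _ _ L w (fun=> intr)) //.
- by rewrite big_ord_recl big_ord0 mulr1 det_scalar1.
- by move=> a; rewrite big_ord_recl big_ord0 addr0 /= intz.
- by move=> k l; rewrite !ord1 eqxx.
- by rewrite unitmxE det_mx11 mxE rmorph1 unitr1.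
Qed.

Lemma det_mul_coords_norm (L : fieldType) (w : L) :
  n.-primitive_root w -> n%:R != 0 :> L ->
  (\det (mul_coords n' e co f))%:~R =
  \prod_(b : {ffun 'I_d -> 'I_n}) leval intr (tpt w b) F.
Proof.
move=> w_prim nL; rewrite -det_mul_coords_int//; congr (_%:~R).
have [v v_prim] := closed_prim_root (@solve_monicpoly R[i]) natC_neq0.
apply: (@intr_inj R[i]); rewrite (det_mul_coords_int v_prim natC_neq0).
rewrite (det_mul_coords coE co_e (w := v) (tau := fun u => tauO u))//.
  rewrite exchange_big; apply: eq_bigr => b _.
  by rewrite leval_field_norm// => i; apply: tpt_neq0.
exact: natC_neq0.
Qed.

End NormDeterminant.

(** * Ultrametric absolute values and dominant coefficients *)

Section AbsoluteValue.
Variables (R : realType) (F : fieldType) (v : F -> R).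
Hypothesis v_abs : is_abs_value v.

Lemma abs_ge0 x : 0 <= v x. Proof. by case: v_abs. Qed.

Lemma absM x y : v (x * y) = v x * v y. Proof. by case: v_abs. Qed.

Lemma abs_eq0 x : (v x == 0) = (x == 0).
Proof. by case: v_abs => _ h _ _; apply/eqP/eqP => /h. Qed.

Lemma abs0 : v 0 = 0. Proof. by apply/eqP; rewrite abs_eq0. Qed.

Lemma abs_gt0 x : (0 < v x) = (x != 0).
Proof. by rewrite lt0r abs_ge0 andbT abs_eq0. Qed.

Lemma absD x y : v (x + y) <= Num.max (v x) (v y).
Proof. by case: v_abs. Qed.

Lemma abs1 : v 1 = 1.
Proof.
have v1 : v 1 != 0 by rewrite abs_eq0 oner_neq0.
by apply: (mulfI v1); rewrite -absM !mulr1.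
Qed.

Lemma absX x n : v (x ^+ n) = v x ^+ n.
Proof. by elim: n => [|n IH]; rewrite ?expr0 ?abs1// !exprS absM IH. Qed.

Lemma absN x : v (- x) = v x.
Proof.
have : v (-1) ^+ 2 = 1 by rewrite -absX sqrrN expr1n abs1.
move/eqP; rewrite sqrf_eq1 => /orP[/eqP e1|/eqP e1].
  by rewrite -mulN1r absM e1 mul1r.
by have := abs_ge0 (-1); rewrite e1 oppr_ge0 ler10.
Qed.

Lemma absV x : v x^-1 = (v x)^-1.
Proof.
have [->|x0] := eqVneq x 0; first by rewrite invr0 abs0 invr0.
have vx : v x != 0 by rewrite abs_eq0.
by apply: (mulfI vx); rewrite -absM !mulfV// abs1.
Qed.

Lemma absB x y : v (x - y) <= Num.max (v x) (v y).
Proof. by rewrite -(absN y) absD. Qed.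

Lemma abs_distC x y : v (x - y) = v (y - x).
Proof. by rewrite -absN opprB. Qed.

Lemma abs_lt_trans x y z e : v (x - y) < e -> v (y - z) < e -> v (x - z) < e.
Proof.
move=> xy yz; rewrite -(subrKA y); apply: le_lt_trans (absD _ _) _.
by rewrite gt_max xy.
Qed.

Lemma abs_sum_lt (I : Type) (s : seq I) (P : pred I) (B : I -> F) e : 0 < e ->
  (forall i, P i -> v (B i) < e) -> v (\sum_(i <- s | P i) B i) < e.
Proof.
move=> e0 Be; apply: (big_ind (fun x => v x < e)) => //; first by rewrite abs0.
by move=> x y xe ye; apply: le_lt_trans (absD _ _) _; rewrite gt_max xe.
Qed.

Lemma abs_sum_le (I : Type) (s : seq I) (P : pred I) (B : I -> F) e : 0 <= e ->
  (forall i, P i -> v (B i) <= e) -> v (\sum_(i <- s | P i) B i) <= e.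
Proof.
move=> e0 Be; apply: (big_ind (fun x => v x <= e)) => //; first by rewrite abs0.
by move=> x y xe ye; apply: le_trans (absD _ _) _; rewrite ge_max xe.
Qed.

Lemma absD_dominant x y : v y < v x -> v (x + y) = v x.
Proof.
move=> yx; apply/eqP; rewrite eq_le; apply/andP; split.
  by apply: le_trans (absD _ _) _; rewrite ge_max lexx ltW.
have := absB (x + y) y; rewrite addrK le_max => /orP[//|].
by rewrite leNgt yx.
Qed.

Lemma abs_exprz_eq1 x (k : int) : v x = 1 -> v (x ^ k) = 1.
Proof.
move=> x1; case: k => k; first by rewrite absX x1 expr1n.
by rewrite NegzE -exprnN absV absX x1 expr1n invr1.
Qed.

Lemma abs_root_unity x n : (0 < n)%N -> x ^+ n = 1 -> v x = 1.
Proof.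
move=> n0 /(congr1 v); rewrite absX abs1 => /eqP.
by rewrite pexpr_eq1// ?abs_ge0// => /eqP.
Qed.

Definition dominant (B : nat -> F) k := forall j, j != k -> v (B j) < v (B k).

Lemma dominant_prod_XsubC (c : F) (rs : seq F) : c != 0 ->
  (forall a, a \in rs -> v a != 1) ->
  exists k, dominant (fun j => (c *: \prod_(a <- rs) ('X - a%:P))`_j) k.
Proof.
move=> c0; elim: rs => [_|a rs IH rs1].
  exists 0%N => j j0; rewrite big_nil !coefZ !coef1 eqxx mulr1 (negPf j0).
  by rewrite mulr0 abs0 abs_gt0.
have [|k kdom] := IH; first by move=> b brs; apply: rs1; rewrite inE brs orbT.
have a1 : v a != 1 by apply: rs1; rewrite inE eqxx.
rewrite big_cons mulrC scalerAl; set g := _ *: _ in kdom *.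
have gk0 : 0 < v g`_k.
  by apply: le_lt_trans (abs_ge0 _) (kdom k.+1 _); rewrite eqn_leq ltnn.
have gle j : v g`_j <= v g`_k.
  by have [->//|jk] := eqVneq j k; apply/ltW/kdom.
have coefE j : (g * ('X - a%:P))`_j =
    (if j == 0%N then 0 else g`_j.-1) - a * g`_j.
  by rewrite mulrBr coefB coefMX coefMC [_ * a]mulrC.
move: a1; rewrite neq_lt => /orP[a1|a1].
  have agl j : v (a * g`_j) < v g`_k.
    rewrite absM; have [gj0|gj0] := eqVneq (v g`_j) 0.
      by rewrite gj0 mulr0.
    apply: lt_le_trans (gle j); rewrite -[ltRHS]mul1r ltr_pM2r//.
    by rewrite lt0r gj0 abs_ge0.
  exists k.+1 => j jk; rewrite !coefE /=.
  rewrite [ltRHS]absD_dominant ?absN//.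
  apply: le_lt_trans (absB _ _) _; rewrite gt_max agl andbT.
  by case: j jk => [|j]; rewrite ?abs0//= eqSS => /kdom.
have agg j : v g`_j < v (a * g`_k).
  apply: le_lt_trans (gle j) _.
  by rewrite absM -[ltLHS]mul1r ltr_pM2r.
exists k => j jk; rewrite !coefE.
rewrite [in ltRHS]addrC [ltRHS]absD_dominant ?absN//; last first.
  by case: ifP => _; [rewrite abs0; apply: lt_trans (agg k)|exact: agg].
apply: le_lt_trans (absB _ _) _; rewrite gt_max; apply/andP; split.
  by case: ifP => _; [rewrite abs0; apply: lt_trans (agg k)|exact: agg].
by rewrite !absM ltr_pM2l ?kdom// (lt_trans ltr01).
Qed.

End AbsoluteValue.

Definition kron (d m : nat) (nu : 'rV[int]_d) : int :=
  \sum_i nu 0 i * (m%:Z ^+ i).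

Lemma kron_inj d (S : seq 'rV[int]_d) :
  exists m : nat, {in S &, injective (kron m)}.
Proof.
pose pol (nu : 'rV[int]_d) : {poly int} := \poly_(i < d)
  (if insub i is Some j then nu 0 (j : 'I_d) else 0).
have pol_inj : injective pol.
  move=> nu mu /polyP E; apply/rowP => i; have := E i.
  by rewrite !coef_poly ltn_ord valK.
have polE m nu : (pol nu).[m%:Z] = kron m nu.
  by rewrite horner_poly; apply: eq_bigr => i _; rewrite valK.
pose P := \prod_(nu <- S) \prod_(mu <- S | nu != mu) (pol nu - pol mu).
have P0 : P != 0.
  rewrite prodf_seq_neq0; apply/allP => nu _ /=.
  rewrite prodf_seq_neq0; apply/allP => mu _ /=; apply/implyP => nm.
  by rewrite subr_eq0 (inj_eq pol_inj).
have [m Pm] : exists m : nat, P.[m%:Z] != 0.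
  have [//|h] := pselect (exists m : nat, P.[m%:Z] != 0).
  pose rs := [seq (i : nat)%:Z | i <- iota 0 (size P)].
  have rsP : all (root P) rs.
    apply/allP => _ /mapP[i _ ->]; apply/rootP/eqP/negPn/negP => Pi.
    by apply: h; exists i.
  have rsU : uniq rs by rewrite map_inj_uniq ?iota_uniq// => i j [].
  by have := max_poly_roots P0 rsP rsU; rewrite size_map size_iota ltnn.
exists m => nu mu nuS muS E; apply/eqP/negPn/negP => nm.
move: Pm; rewrite horner_prod prodf_seq_neq0 => /allP/(_ nu nuS) /=.
rewrite horner_prod prodf_seq_neq0 => /allP/(_ mu muS) /=.
by rewrite nm /= hornerD hornerN !polE E subrr eqxx.
Qed.

Lemma seq_max_exists (T : eqType) (R : realDomainType) (g : T -> R) (x0 : T)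
    (s : seq T) :
  x0 \in s -> exists2 x, x \in s & forall y, y \in s -> g y <= g x.
Proof.
elim: s x0 => // a s IH x0 _; case: s IH => [_|b s IH].
  by exists a; rewrite ?inE// => y; rewrite inE => /eqP ->.
have [|x xs xmax] := IH b; first by rewrite inE eqxx.
have [ax|xa] := leP (g a) (g x).
  exists x; first by rewrite inE xs orbT.
  by move=> y; rewrite inE => /orP[/eqP ->//|/xmax].
exists a; first by rewrite inE eqxx.
by move=> y; rewrite inE => /orP[/eqP ->//|/xmax/le_trans]; apply; apply: ltW.
Qed.

Section DominantCoefficient.
Variables (R : realType) (W : fieldType) (v : W -> R) (d : nat).
Hypothesis v_abs : is_abs_value v.
Hypothesis W_closed : GRing.closed_field_axiom W.
Hypothesis W_char0 : injective (intr : int -> W).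

Lemma monom_val_kron (a : W) m (nu : 'rV[int]_d) : a != 0 ->
  monom_val (\row_i a ^+ (m ^ i)) nu = a ^ kron m nu.
Proof.
move=> a0; rewrite /kron.
rewrite (big_morph (exprz a) (id1 := 1) (op1 := *%R)) ?expr0z//; last first.
  by move=> x y; rewrite expfzDr.
apply: eq_bigr => i _; rewrite mxE exprnP exprz_exp mulrC; congr (_ ^ (_ * _)).
by rewrite -(natz m) -natrX natz.
Qed.

(* If two coefficients have maximal absolute value, a Kronecker substitution
   t_i = u^(m^i) yields a polynomial in u whose Newton polygon has a horizontal
   edge, hence a root of absolute value 1. *)
Lemma dominant_coef (g : laurent d int) : g != 0 ->
  (forall z : 'rV[W]_d, (forall i, v (z 0 i) = 1) -> leval intr z g != 0) ->
  exists2 nu, 0 < v (g@_nu)%:~R &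
    forall mu, mu != nu -> v (g@_mu)%:~R < v (g@_nu)%:~R.
Proof.
move=> g0 g_nz; pose s : seq _ := msupp g.
have us : uniq s by exact: fset_uniq.
have [nu0 nu0s] : exists nu0, nu0 \in s.
  case Es : s => [|x s']; last by exists x; rewrite inE eqxx.
  by move: g0; rewrite [g]laurent_mono [X in \sum_(i <- X) _]Es big_nil eqxx.
have [nu nus nu_max] := seq_max_exists (fun x => v (g@_x)%:~R) nu0s.
have nu_gt0 : 0 < v (g@_nu)%:~R.
  by rewrite abs_gt0// -(mulr0z 1) (inj_eq W_char0) mcoeff_neq0.
exists nu => // mu mu_nu; rewrite ltNge; apply/negP => mu_ge.
have mus : mu \in s.
  rewrite /s -mcoeff_neq0; apply: contraTneq (lt_le_trans nu_gt0 mu_ge) => ->.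
  by rewrite mulr0z (abs0 v_abs) ltxx.
have [m m_inj] := kron_inj s.
pose S : int := \sum_(x <- s) `|kron m x|.
have S_ge x : x \in s -> 0 <= kron m x + S.
  move=> xs; rewrite -lerBlDl sub0r (le_trans (ler_norm _))// normrN.
  by rewrite /S (bigD1_seq x)//= lerDl sumr_ge0.
pose e (x : 'rV[int]_d) := absz (kron m x + S).
have eE x : x \in s -> (e x : int) = kron m x + S.
  by move=> /S_ge; exact: gez0_abs.
have e_inj : {in s &, injective e}.
  move=> x y xs ys exy; apply: m_inj => //; apply: (addIr S).
  by rewrite -!eE// exy.
pose h : {poly W} := \sum_(x <- s) (g@_x)%:~R *: 'X^(e x).
have hcoef k : h`_k = \sum_(x <- s) (g@_x)%:~R *+ (k == e x).
  rewrite /h coef_sum; apply: eq_bigr => x _.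
  by rewrite coefZ coefXn mulr_natr.
have h_le k : v h`_k <= v (g@_nu)%:~R.
  rewrite hcoef big_seq; apply: abs_sum_le => //; first exact: ltW.
  move=> x xs; case: (k == _); first by rewrite mulr1n nu_max.
  by rewrite mulr0n (abs0 v_abs) ltW.
have hcoef_e x : x \in s -> h`_(e x) = (g@_x)%:~R.
  move=> xs; rewrite hcoef (bigD1_seq x)//= eqxx mulr1n.
  rewrite big_seq_cond big1 ?addr0//.
  move=> y /andP[ys yx]; rewrite eq_sym; case: eqP => // /e_inj E.
  by rewrite E ?eqxx in yx.
have h0 : h != 0.
  apply: contraTneq nu_gt0 => hE; have := hcoef_e _ nus.
  by rewrite hE coef0 => <-; rewrite (abs0 v_abs) ltxx.
have [rs hE] := closed_field_split W_closed h.
have [h_nr|] := pselect (forall a, a \in rs -> v a != 1).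
  have [|k kdom] := dominant_prod_XsubC v_abs (c := lead_coef h) _ h_nr.
    by rewrite lead_coef_eq0.
  rewrite -hE in kdom.
  have [nuk|nuk] := eqVneq (e nu) k.
    have muk : e mu != k.
      by rewrite -nuk; apply: contraNneq mu_nu => /e_inj ->.
    have := kdom _ muk; rewrite hcoef_e// => /(le_lt_trans mu_ge).
    by rewrite ltNge h_le.
  by have := kdom _ nuk; rewrite hcoef_e// ltNge h_le.
move=> /existsNP[a /not_implyP[ars /negP/negPn/eqP a1]].
have ha : h.[a] = 0.
  by apply/rootP; rewrite hE rootZ ?lead_coef_eq0// root_prod_XsubC.
have a0 : a != 0 by rewrite -(abs_gt0 v_abs) a1.
have zP i : v ((\row_i a ^+ (m ^ i) : 'rV[W]_d) 0 i) = 1.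
  by rewrite mxE (absX v_abs) a1 expr1n.
case/negP: (g_nz _ zP); apply/eqP; apply: (mulIf (_ : a ^ S != 0)).
  by rewrite expfz_neq0.
rewrite mul0r -ha /leval /mmap mulr_suml /h horner_sum.
rewrite big_seq [RHS]big_seq; apply: eq_bigr => x xs.
rewrite hornerZ hornerXn -mulrA monom_val_kron// -expfzDr//.
by rewrite -eE.
Qed.

End DominantCoefficient.

(** * Means of p-adic logarithms *)

Lemma pow_growth (R : realFieldType) (t : R) k : 0 <= t ->
  (k%:R * k.-1%:R) * t ^+ 2 <= 2 * (1 + t) ^+ k.
Proof.
move=> t0; have bern : forall k, 1 + k%:R * t <= (1 + t) ^+ k.
  elim=> [|l IH]; first by rewrite mul0r addr0 expr0.
  rewrite exprS; apply: le_trans (ler_wpM2l _ IH); last by rewrite addr_ge0.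
  rewrite -subr_ge0 (_ : _ - _ = l%:R * t ^+ 2) ?mulr_ge0 ?sqr_ge0//.
  by rewrite -[l.+1%:R]natr1; ring.
elim: k => [|k IH]; first by rewrite !mul0r mulr_ge0// expr0.
have -> : k.+1%:R * k.+1.-1%:R * t ^+ 2 =
    k%:R * k.-1%:R * t ^+ 2 + 2 * (k%:R * t) * t.
  case: k {IH} => [|k] /=; first by ring.
  by rewrite -[k.+2%:R]natr1 -[k.+1%:R]natr1; ring.
have -> : 2 * (1 + t) ^+ k.+1 = 2 * (1 + t) ^+ k + 2 * (1 + t) ^+ k * t.
  by rewrite exprSr; ring.
apply: lerD => //; apply: ler_wpM2r => //; apply: ler_wpM2l => //.
by apply: le_trans (bern k); rewrite lerDr.
Qed.

Lemma geometric_linear_small (R : realType) (rho e : R) :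
  0 < rho < 1 -> 0 < e ->
  exists k0 : nat, forall k, (k0 <= k)%N -> k%:R * rho ^+ k < e.
Proof.
move=> /andP[rho0 rho1] e0; pose t := rho^-1 - 1.
have t0 : 0 < t by rewrite subr_gt0 invf_gt1.
have q0 : 0 < 2 / (e * t ^+ 2) by rewrite divr_gt0 ?mulr_gt0 ?exprn_gt0.
have := archi_boundP (ltW q0); set N := Num.bound _ => NE.
exists N.+1 => -[//|k] Nk.
have kt : 0 < k%:R * t ^+ 2.
  by rewrite mulr_gt0 ?exprn_gt0// (lt_trans q0)// (lt_le_trans NE)// ler_nat.
have rhoE : (1 + t) ^+ k.+1 = rho ^- k.+1 by rewrite /t addrC subrK exprVn.
rewrite -(ltr_pM2r kt); apply: (@le_lt_trans _ _ 2).
  rewrite -(ler_pM2r (_ : 0 < (1 + t) ^+ k.+1)).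
    rewrite (_ : _ * _ * _ = k.+1%:R * k%:R * t ^+ 2).
      by apply: (pow_growth k.+1); apply: ltW.
    rewrite rhoE -[RHS]mulr1 -(mulfV (_ : rho ^+ k.+1 != 0)); first by ring.
    by rewrite expf_neq0// gt_eqF.
  by rewrite exprn_gt0// addr_gt0.
rewrite mulrCA -ltr_pdivrMr; last by rewrite mulr_gt0 ?exprn_gt0.
by apply: lt_le_trans NE _; rewrite ler_nat.
Qed.

Section PadicNumbers.
Variables (R : realType) (p : nat) (C : padic_complex R p).
Hypothesis p_prime : prime p.
Local Notation v := (@Cp_abs R p C).

Lemma Cp_abs_value : is_abs_value v. Proof. by case: (CpP C). Qed.

Lemma Cp_abs_of_Qpbar x : v (Cp_of_Qpbar C x) = Qpbar_abs x.
Proof. by case: (CpP C). Qed.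

Lemma Qpbar_abs_int (m : int) : @Qpbar_abs R p C m%:~R = rat_abs R p m%:~R.
Proof.
have [_ QpE _ _] := QpP C.
by rewrite -QpE -Qpbar_absE !rmorph_int.
Qed.

Lemma Cp_abs_int (m : int) : v m%:~R = rat_abs R p m%:~R.
Proof. by rewrite -Qpbar_abs_int -Cp_abs_of_Qpbar rmorph_int. Qed.

Lemma Cp_abs_nat n : (0 < n)%N -> v n%:R = (p%:R ^+ logn p n)^-1.
Proof.
move=> n0; rewrite -[n%:R]/(n%:Z%:~R) Cp_abs_int /rat_abs intr_eq0.
rewrite -[_ == _]/(n == 0)%N.
by rewrite eqn0Ngt n0 /= denq_int numq_int logn1 expr0 mul1r.
Qed.

Lemma coprime_gt0 n : coprime n p -> (0 < n)%N.
Proof.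
case: n => //; rewrite /coprime gcd0n => /eqP p1.
by have := prime_gt1 p_prime; rewrite p1.
Qed.

Lemma Cp_abs_coprime n : coprime n p -> v n%:R = 1.
Proof.
move=> n_cop; rewrite Cp_abs_nat ?coprime_gt0// logn_coprime ?expr0 ?invr1//.
by rewrite coprime_sym.
Qed.

Lemma Cp_abs_invn n : (0 < n)%N -> v n%:R^-1 <= n%:R.
Proof.
move=> n0; rewrite (absV Cp_abs_value) Cp_abs_nat// invrK -natrX ler_nat.
by rewrite dvdn_leq// pfactor_dvdnn.
Qed.

Lemma Cp_natr_neq0 n : (0 < n)%N -> n%:R != 0 :> C.
Proof.
move=> n0; rewrite -(abs_gt0 Cp_abs_value) Cp_abs_nat// invr_gt0 exprn_gt0//.
by rewrite ltr0n prime_gt0.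
Qed.

Lemma Qpbar_int_inj : injective (intr : int -> Qpbar C).
Proof.
move=> m m'; rewrite -!(rmorph_int (Qpbar_of_Qp C \o Qp_of_rat C)).
move=> /fmorph_inj.
exact: intr_inj.
Qed.

Lemma Cp_prim_root n : (0 < n)%N -> exists w : C, n.-primitive_root w.
Proof.
move=> n0; have nQ : n%:R != 0 :> Qpbar C.
  by rewrite -(fmorph_eq0 (Cp_of_Qpbar C)) rmorph_nat Cp_natr_neq0.
have [w w_prim] := closed_prim_root (@Qpbar_closed _ _ C) nQ.
by exists (Cp_of_Qpbar C w); rewrite fmorph_primitive_root.
Qed.

Lemma coprime_cauchy_cvg (u : nat -> C) :
  (forall e : R, 0 < e -> exists (a : C) (N : nat), forall n, (N <= n)%N ->
     coprime n p -> v (u n - a) < e) ->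
  exists l, coprime_cvg u l.
Proof.
move=> u_cauchy; have [_ _ _ complete] := CpP C.
have cop m : coprime (p * m).+1 p.
  exact: (coprime_dvdr (dvdn_mulr m (dvdnn p)) (coprimeSn _)).
have far N m : (N <= m)%N -> (N <= (p * m).+1)%N.
  by move=> /leq_trans; apply; rewrite leqW// leq_pmull// prime_gt0.
have [l lP] : exists l, abs_cvg v (fun m => u (p * m).+1) l.
  apply: complete => e e0; have [a [N uN]] := u_cauchy e e0.
  exists N => m n mN nN; apply: (abs_lt_trans Cp_abs_value (y := a)).
    by apply: uN => //; apply: far.
  by rewrite (abs_distC Cp_abs_value); apply: uN => //; apply: far.
exists l => e e0; have [a [N uN]] := u_cauchy e e0.
have [M uM] := lP e e0; exists N => n nN n_cop.
have mN : (N <= maxn M N)%N by rewrite leq_maxr.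
apply: (abs_lt_trans Cp_abs_value (y := a)); first exact: uN.
apply: (abs_lt_trans Cp_abs_value (y := u (p * maxn M N).+1)).
  by rewrite (abs_distC Cp_abs_value); apply: uN => //; apply: far.
by apply: uM; rewrite leq_maxl.
Qed.

Section Logarithm.
Variable L : C -> C.
Hypothesis L_log : is_padic_log L.

Lemma logM x y : x != 0 -> y != 0 -> L (x * y) = L x + L y.
Proof. by case: L_log => _ h _ _; apply: h. Qed.

Lemma log1 : L 1 = 0.
Proof.
by apply: (addrI (L 1)); rewrite addr0 -logM ?oner_neq0// mulr1.
Qed.

Lemma logX x n : x != 0 -> L (x ^+ n) = L x *+ n.
Proof.
move=> x0; elim: n => [|n IH]; first by rewrite expr0 log1 mulr0n.
by rewrite exprS logM ?expf_neq0// IH mulrS.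
Qed.

Lemma log_root_unity x n : (0 < n)%N -> x ^+ n = 1 -> L x = 0.
Proof.
move=> n0 xn; have x0 : x != 0.
  apply: contra_eq_neq xn => ->; rewrite expr0n eqn0Ngt n0 eq_sym.
  exact: oner_neq0.
have /eqP := logX n x0; rewrite xn log1 -mulr_natr eq_sym mulf_eq0.
by rewrite (negPf (Cp_natr_neq0 n0)) orbF => /eqP.
Qed.

Lemma logN x : L (- x) = L x.
Proof.
have [->|x0] := eqVneq x 0; first by rewrite oppr0.
rewrite -mulN1r logM ?oppr_eq0 ?oner_neq0//.
by rewrite (@log_root_unity (-1) 2) ?add0r// sqrrN expr1n.
Qed.

Lemma log_prod (I : Type) (s : seq I) (B : I -> C) :
  (forall i, B i != 0) -> L (\prod_(i <- s) B i) = \sum_(i <- s) L (B i).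
Proof.
move=> B0; elim: s => [|i s IH]; first by rewrite !big_nil log1.
rewrite !big_cons logM// ?IH//.
by elim: s {IH} => [|j s h]; rewrite ?big_nil ?oner_neq0// big_cons mulf_neq0.
Qed.

Definition log_series k0 (x : C) : C :=
  \sum_(k < k0) (-1) ^+ k * x ^+ k.+1 / k.+1%:R.

Lemma log_approx (rho e : R) : 0 < rho < 1 -> 0 < e ->
  exists k0, forall x, v x <= rho -> v (L (1 + x) - log_series k0 x) < e.
Proof.
move=> rho01 e0; have [k0 k0P] := geometric_linear_small rho01 e0.
have /andP[rho0 rho1] := rho01.
exists k0 => x xrho.
have [_ _ _ /(_ x (le_lt_trans xrho rho1))/(_ e e0)[N NP]] := L_log.
apply: (abs_lt_trans Cp_abs_value (y := log_series (maxn N k0) x)).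
  by rewrite (abs_distC Cp_abs_value); apply: NP; rewrite leq_maxl.
rewrite /log_series.
rewrite -!(big_mkord xpredT (fun k => (-1) ^+ k * x ^+ k.+1 / k.+1%:R)).
rewrite (big_cat_nat _ (n := k0)) ?leq_maxr//= [X in v X]addrC addKr.
rewrite big_nat_cond; apply: (abs_sum_lt Cp_abs_value) => // k.
rewrite andbT => /andP[k0k _].
apply: le_lt_trans (k0P k.+1 (leqW k0k)).
rewrite !(absM Cp_abs_value) !(absX Cp_abs_value) (absN Cp_abs_value).
rewrite (abs1 Cp_abs_value) expr1n mul1r mulrC.
apply: ler_pM => //; rewrite ?exprn_ge0 ?(abs_ge0 Cp_abs_value)//.
  exact: Cp_abs_invn.
by rewrite lerXn2r// ?nnegrE ?(abs_ge0 Cp_abs_value)// ltW.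
Qed.

End Logarithm.

Lemma torus_average d (P : laurent d C) :
  exists N, forall n' (w : C), (N <= n'.+1)%N -> n'.+1.-primitive_root w ->
    n'.+1%:R ^- d *
      \sum_(b : {ffun 'I_d -> 'I_n'.+1}) leval idfun (tpt w b) P = P@_0.
Proof.
pose N := (\sum_(nu <- msupp P) \sum_i `|nu 0%R i|).+1.
exists N => n' w Nn w_prim.
have n0 : n'.+1%:R ^+ d != 0 :> C by rewrite expf_neq0// Cp_natr_neq0.
rewrite /leval /mmap exchange_big /=.
transitivity (\sum_(nu <- msupp P) P@_nu *+ (nu == 0)).
  rewrite mulr_sumr big_seq [RHS]big_seq; apply: eq_bigr => nu nuP.
  rewrite -mulr_sumr (sum_tpt w_prim) mulrCA mulrnAr mulVf// mulr_natr.
  congr (_ *+ nat_of_bool _); apply/idP/eqP => [|->//]; rewrite res_eq subr0.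
  move=> /forallP nu_dvd; apply/rowP => i; rewrite mxE.
  apply/eqP; rewrite -absz_eq0; apply/negPn/negP; rewrite -lt0n => nui.
  have := dvdn_leq nui (nu_dvd i); apply/negP; rewrite -ltnNge.
  apply: leq_trans Nn; rewrite ltnS.
  rewrite (bigD1_seq nu) ?fset_uniq//= (bigD1 i)//= -addnA leq_addr.
  by [].
have [P0|P0] := boolP (0 \in msupp P).
  rewrite (bigD1_seq 0) ?fset_uniq//= eqxx big1 ?addr0//.
  by move=> nu /negPf ->.
rewrite mcoeff_outdom// big_seq big1// => nu nuP.
by case: eqP nuP => // ->; rewrite (negPf P0).
Qed.

End PadicNumbers.

Section MeanLogarithm.
Variables (R : realType) (p d : nat) (C : padic_complex R p) (L : C -> C).
Hypothesis p_prime : prime p.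
Hypothesis L_log : is_padic_log L.
Local Notation v := (@Cp_abs R p C).

Lemma uniform_bound (T : eqType) (s : seq T) (B : T -> R) :
  (forall x, x \in s -> B x < 1) ->
  exists2 rho, 0 < rho < 1 & forall x, x \in s -> B x <= rho.
Proof.
elim: s => [_|a s IH B1].
  by exists 2^-1 => //; rewrite invr_gt0 ltr0n invf_lt1 ?ltr0n// ltr1n.
have [|rho /andP[rho0 rho1] rhoP] := IH.
  by move=> x xs; apply: B1; rewrite inE xs orbT.
exists (Num.max rho (B a)).
  by rewrite lt_max rho0 gt_max rho1 B1// inE eqxx.
move=> x; rewrite inE => /orP[/eqP ->|/rhoP h].
  by rewrite le_max lexx orbT.
by rewrite le_max h.
Qed.

Variables (g : laurent d int) (nu : 'rV[int]_d).
Hypothesis nu_gt0 : 0 < v (g@_nu)%:~R.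
Hypothesis nu_dom : forall mu, mu != nu -> v (g@_mu)%:~R < v (g@_nu)%:~R.

Local Notation c := ((g@_nu)%:~R : C).

Definition tail : laurent d C :=
  \sum_(mu <- msupp g | mu != nu) mono (mu - nu) ((g@_mu)%:~R / c).

Lemma dominant_neq0 : c != 0.
Proof. by rewrite -(abs_gt0 (Cp_abs_value C)). Qed.

Lemma leval_tail (z : 'rV[C]_d) : (forall i, z 0 i != 0) ->
  leval intr z g = c * monom_val z nu * (1 + leval idfun z tail).
Proof.
move=> z0; rewrite mulrDr mulr1 /tail raddf_sum mulr_sumr.
have nus : nu \in msupp g.
  rewrite -mcoeff_neq0; apply: contraNneq dominant_neq0 => ->.
  by rewrite mulr0z.
rewrite [LHS]/leval /mmap (bigD1_seq nu) ?fset_uniq//=; congr (_ + _).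
apply: eq_bigr => mu _; rewrite levalU /= mulrACA -monom_valD//.
by rewrite addrC subrK [c * _]mulrC divfK// dominant_neq0.
Qed.

Lemma tail_small : exists2 rho, 0 < rho < 1 & forall z : 'rV[C]_d,
  (forall i, v (z 0 i) = 1) -> v (leval idfun z tail) <= rho.
Proof.
have vA := Cp_abs_value C.
pose s := [seq mu <- msupp g | mu != nu].
have [|rho rho01 rhoP] := @uniform_bound _ s (fun mu => v ((g@_mu)%:~R / c)).
  move=> mu; rewrite mem_filter => /andP[mn _].
  by rewrite (absM vA) (absV vA) ltr_pdivrMr// mul1r nu_dom.
exists rho => // z z1; have /andP[rho0 _] := rho01.
rewrite /tail -big_filter raddf_sum big_seq.
apply: (abs_sum_le vA); first exact: ltW.
move=> mu mus; rewrite /= levalU (absM vA) /monom_val.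
rewrite [X in _ * X](_ : _ = 1) ?mulr1; first exact: rhoP.
rewrite (big_morph v (absM vA) (abs1 vA)) big1// => i _.
exact: abs_exprz_eq1.
Qed.

Definition tail_series k0 : laurent d C :=
  \sum_(k < k0) mono 0 ((-1) ^+ k / k.+1%:R) * tail ^+ k.+1.

Lemma leval_tail_series k0 (z : 'rV[C]_d) : (forall i, z 0 i != 0) ->
  leval idfun z (tail_series k0) = log_series k0 (leval idfun z tail).
Proof.
move=> z0; have [phi phiE] := leval_rmorphism (idfun : {rmorphism C -> C}) z0.
rewrite -!phiE rmorph_sum; apply: eq_bigr => k _.
rewrite rmorphM rmorphXn /= [phi (mono _ _)]phiE levalU monom_val0.
by rewrite mulr1 mulrAC.
Qed.

Lemma log_mean_cauchy (e : R) : 0 < e -> exists (a : C) (N : nat),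
  forall n' (w : C), (N <= n'.+1)%N -> coprime n'.+1 p ->
    n'.+1.-primitive_root w ->
    v (n'.+1%:R ^- d * \sum_(b : {ffun 'I_d -> 'I_n'.+1})
         L (leval intr (tpt w b) g) - a) < e.
Proof.
move=> e0; have vA := Cp_abs_value C.
have [rho rho01 tail_rho] := tail_small; have /andP[_ rho1] := rho01.
have [k0 k0P] := log_approx L_log rho01 e0.
have [N NP] := torus_average p_prime (tail_series k0).
exists (L c + (tail_series k0)@_0), N => n' w Nn n_cop w_prim.
have n0 : n'.+1%:R ^+ d != 0 :> C by rewrite expf_neq0// Cp_natr_neq0.
have z0 (b : {ffun 'I_d -> 'I_n'.+1}) i : tpt w b 0 i != 0.
  exact: tpt_neq0.
have z1 (b : {ffun 'I_d -> 'I_n'.+1}) i : v (tpt w b 0 i) = 1.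
  apply: (abs_root_unity vA (ltn0Sn n')); rewrite mxE exprAC.
  by rewrite (prim_expr_order w_prim) expr1n.
have LE (b : {ffun 'I_d -> 'I_n'.+1}) : L (leval intr (tpt w b) g) =
    L c + L (1 + leval idfun (tpt w b) tail).
  have m0 : monom_val (tpt w b) nu != 0.
    by apply/prodf_neq0 => i _; rewrite expfz_neq0 ?z0.
  have t0 : 1 + leval idfun (tpt w b) tail != 0.
    rewrite -(abs_gt0 vA) (absD_dominant vA) (abs1 vA)//.
    exact: le_lt_trans (tail_rho _ (z1 b)) rho1.
  rewrite leval_tail// (logM L_log) ?mulf_neq0 ?dominant_neq0//.
  rewrite (logM L_log) ?dominant_neq0//.
  suff -> : L (monom_val (tpt w b) nu) = 0 by rewrite addr0.
  apply: (log_root_unity p_prime L_log (ltn0Sn n')).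
  rewrite -prodrXl big1// => i _; rewrite exprnP exprzAC -exprnP mxE exprAC.
  by rewrite (prim_expr_order w_prim) expr1n exp1rz.
rewrite (eq_bigr _ (fun b _ => LE b)) big_split /= mulrDr.
rewrite sumr_const card_ffun !card_ord -[L c *+ _]mulr_natl natrX mulKf//.
rewrite -(NP n' w Nn w_prim) opprD addrACA subrr add0r -mulrBr -sumrB.
rewrite (absM vA) (absV vA) (absX vA) (Cp_abs_coprime C p_prime n_cop) expr1n.
rewrite invr1 mul1r; apply: (abs_sum_lt vA) => // b _.
by rewrite leval_tail_series//; apply: k0P; apply: tail_rho.
Qed.

End MeanLogarithm.

Lemma sum_mu_torus (R : realType) (p d n' : nat) (C : padic_complex R p) (w : C)
    (B : 'rV[C]_d -> C) : n'.+1.-primitive_root w ->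
  \sum_(z \in @mu_torus R p C d n'.+1) B z =
  \sum_(b : {ffun 'I_d -> 'I_n'.+1}) B (tpt w b).
Proof.
move=> w_prim; rewrite (reindex_fsbig (@tpt d n' C w) setT); last first.
  split=> [b _ i|b b' _ _ E|z zn].
  - by rewrite mxE exprAC (prim_expr_order w_prim) expr1n.
  - apply/ffunP => i; apply/val_inj/eqP; move/rowP/(_ i): E; rewrite !mxE.
    by move/eqP; rewrite (eq_prim_root_expr w_prim) !modn_small.
  - have /choice[b bE] i : exists k : 'I_n'.+1, z 0 i = w ^+ k.
      by have [k] := prim_rootP w_prim (zn i); exists k.
    by exists [ffun i => b i] => //; apply/rowP => i; rewrite mxE ffunE bE.
rewrite (_ : setT = [set` index_enum {ffun 'I_d -> 'I_n'.+1}]); last first.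
  by apply/seteqP; split=> // b _ /=; rewrite mem_index_enum.
by rewrite -fsbig_seq// index_enum_uniq.
Qed.

Theorem theorem2p4 (R : realType) (p d s : nat) (C : padic_complex R p)
  (K : fieldExtType rat) (f : 'M[laurent d (ring_of_integers K)]_s)
  (p_prime : prime p) (d_ge1 : (1 <= d)%N) (s_ge1 : (1 <= s)%N)
  (f_nonvanishing : forall z : 'rV[C]_d, unit_torus z ->
     laurent_eval (laurent_map intr (field_norm R (\det f))) z != 0) :
  exists h : C,
    has_padic_entropy (@Xdual_act R _ d s f) h /\
    has_padic_mahler (laurent_map intr (field_norm R (\det f))) h.
Proof.
have vA := Cp_abs_value C.
set F := field_norm R (\det f).
have evalE z : laurent_eval (laurent_map intr F) z = leval intr z F :> C.
  exact: laurent_eval_map.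
have F_neq0 : F != 0.
  have := f_nonvanishing (const_mx 1).
  rewrite -/F evalE => h; apply: contraTneq (h _) => [->|i].
    by rewrite raddf0 eqxx.
  by rewrite mxE (abs1 vA).
have [r [e [co [tau [coE co_e tau_unit tau_inj tau_surj]]]]] :=
  integral_basis K R[i].
have mu_unit n' (z : 'rV[C]_d) : mu_torus n'.+1 z -> unit_torus z.
  by move=> zn i; apply: (abs_root_unity vA (ltn0Sn n')).
pose D n := \det (mul_coords n.-1 e co f).
have DE n' (w : C) : coprime n'.+1 p -> n'.+1.-primitive_root w ->
    (D n'.+1)%:~R = \prod_(b : {ffun 'I_d -> 'I_n'.+1}) leval intr (tpt w b) F.
  move=> n_cop w_prim.
  apply: (det_mul_coords_norm coE co_e tau_unit tau_inj tau_surj) => //.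
  exact: Cp_natr_neq0.
have F_mu n' (w : C) (b : {ffun 'I_d -> 'I_n'.+1}) : n'.+1.-primitive_root w ->
    leval intr (tpt w b) F != 0.
  move=> w_prim; rewrite -evalE; apply/f_nonvanishing/(@mu_unit n') => i.
  by rewrite mxE exprAC (prim_expr_order w_prim) expr1n.
have card_FixE n : coprime n p ->
    (Fix (@Xdual_act R _ d s f) n #= `I_`|D n|%N)%card.
  case: n => [/(coprime_gt0 p_prime)//|n'] n_cop.
  have [w w_prim] := Cp_prim_root C p_prime (ltn0Sn n').
  apply: card_Fix => //; rewrite -[\det _]/(D n'.+1).
  have : (D n'.+1)%:~R != 0 :> C.
    by rewrite (DE _ _ n_cop w_prim); apply/prodf_neq0 => b _; apply: F_mu.
  by apply: contraNneq => ->; rewrite mulr0z.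
have mahler0 N : coprime N p -> forall z : 'rV[C]_d, mu_torus N z ->
    laurent_eval (laurent_map intr F) z != 0.
  case: N => [/(coprime_gt0 p_prime)//|n'] _ z zn.
  exact/f_nonvanishing/(@mu_unit n').
pose L : C -> C := @padic_log R p C.
(* [padic_log] is 0 if there is no logarithm, so none has to be constructed. *)
have [L_log|no_log] := pselect (is_padic_log L); last first.
  have L0 x : L x = 0.
    rewrite /L /padic_log; case: xgetP => // l _ l_log.
    by case: no_log; apply: xgetPex; exists l.
  exists 0; split.
    exists (fun n => `|D n|%N); split=> // eps eps0; exists 0%N => n _ _.
    by rewrite -/L L0 mulr0 subr0 (abs0 vA).
  split=> // eps eps0; exists 0%N => n _ _.
  rewrite fsbig1 => [|z _]; last exact: L0.
  by rewrite mulr0 subr0 (abs0 vA).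
have [nu nu_gt0 nu_dom] : exists2 nu, 0 < Cp_abs ((F@_nu)%:~R : C) &
    forall mu, mu != nu -> Cp_abs ((F@_mu)%:~R : C) < Cp_abs ((F@_nu)%:~R : C).
  have v_int m : Cp_abs (m%:~R : C) = Qpbar_abs (m%:~R : Qpbar C).
    by rewrite Cp_abs_int Qpbar_abs_int.
  have [|nu nu_gt0 nu_dom] := @dominant_coef R (Qpbar C) (@Qpbar_abs R p C) d
      (@Qpbar_absP R p C) (@Qpbar_closed R p C) (@Qpbar_int_inj R p C) F F_neq0.
    move=> z z1; have := f_nonvanishing (map_mx (Cp_of_Qpbar C) z).
    rewrite -/F evalE => h; apply: contraTneq (h _) => [Fz|i].
      rewrite negbK -(rmorph0 (Cp_of_Qpbar C)) -Fz; apply/eqP.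
      rewrite /leval /mmap rmorph_sum; apply: eq_bigr => mu _.
      rewrite rmorphM rmorph_int rmorph_prod; congr (_ * _).
      by apply: eq_bigr => i _; rewrite mxE fmorphXz.
    by rewrite mxE Cp_abs_of_Qpbar z1.
  by exists nu; [rewrite v_int|move=> mu mn; rewrite !v_int; apply: nu_dom].
pose u n := (n%:R ^+ d)^-1 * L (`|D n|%N)%:R.
have uE n' (w : C) : coprime n'.+1 p -> n'.+1.-primitive_root w ->
    u n'.+1 = n'.+1%:R ^- d * \sum_(b : {ffun 'I_d -> 'I_n'.+1})
      L (leval intr (tpt w b) F).
  move=> n_cop w_prim; congr (_ * _).
  have -> : L (`|D n'.+1|%N)%:R = L (D n'.+1)%:~R.
    rewrite [in RHS](intEsign (D n'.+1)) intrM; case: (_ < 0).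
      by rewrite mulN1r (logN p_prime L_log).
    by rewrite mul1r.
  by rewrite (DE _ _ n_cop w_prim) (log_prod L_log)// => b; apply: F_mu.
have [h hP] : exists h, coprime_cvg u h.
  apply: (coprime_cauchy_cvg p_prime) => eps eps0.
  have [a [N NP]] := log_mean_cauchy p_prime L_log nu_gt0 nu_dom eps0.
  exists a, N => -[_ /(coprime_gt0 p_prime)//|n'] Nn n_cop.
  have [w w_prim] := Cp_prim_root C p_prime (ltn0Sn n').
  by rewrite (uE _ w)//; apply: NP.
exists h; split.
  by exists (fun n => `|D n|%N).
split=> // eps eps0; have [N NP] := hP eps eps0.
exists N => -[_ /(coprime_gt0 p_prime)//|n'] Nn n_cop.
have [w w_prim] := Cp_prim_root C p_prime (ltn0Sn n').
rewrite (sum_mu_torus _ w_prim).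
have := NP _ Nn n_cop; rewrite (uE _ w)//; congr (Cp_abs (_ * _ - _) < _).
by apply: eq_bigr => b _; rewrite evalE.
Qed.
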